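(* Let $(E,[\![\cdot,\cdot]\!],\rho)$ be a Lie algebroid over a manifold $Q$, let $L:E\times\mathbb{R}\to\mathbb{R}$ be a hyperregular Lagrangian with Legendre transformation $\mathrm{Leg}_L$, and let $H=E_L\circ\mathrm{Leg}_L^{-1}:E^*\times\mathbb{R}\to\mathbb{R}$. Then the Lagrangian section $\Gamma_L$ associated to $L$ and the Hamiltonian section $\xi_H$ associated to $H$ are $(\mathcal{T}^E\mathrm{Leg}_L,\mathrm{Leg}_L)$-related, that is, $$\xi_H\circ\mathrm{Leg}_L=\mathcal{T}^E\mathrm{Leg}_L\circ\Gamma_L .$$ Moreover, if $\widetilde c:I\subset\mathbb{R}\to E\times\mathbb{R}$ is a solution of the Herglotz equations associated to $L$, then $\sigma=\mathrm{Leg}_L\circ\widetilde c:I\subset\mathbb{R}\to E^*\times\mathbb{R}$ is a solution of the contact Hamilton equations associated to $H$; and, conversely, if $\sigma:I\subset\mathbb{R}\to E^*\times\mathbb{R}$ is a solution of the contact Hamilton equations associated to $H$, then $\widetilde c=\mathrm{Leg}_L^{-1}\circ\sigma$ is a solution of the Herglotz equations associated to $L$.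
   Context: All manifolds and maps are $C^\infty$; repeated indices are summed. Lie algebroids. A Lie algebroid $(E,[\![\cdot,\cdot]\!],\rho)$ over $Q$ is a vector bundle $\tau:E\to Q$ with a Lie bracket $[\![\cdot,\cdot]\!]$ on its sections $Sec(E)$ and a vector bundle map $\rho:E\to TQ$ (anchor) such that $[\![\sigma_1,f\sigma_2]\!]=f[\![\sigma_1,\sigma_2]\!]+(\rho(\sigma_1)f)\sigma_2$ for $f\in C^\infty(Q)$. In local coordinates $(q^i)$ on $Q$ and a local basis $\{e_\alpha\}$ of $Sec(E)$, the structure functions are defined by $\rho(e_\alpha)=\rho^i_\alpha\,\partial/\partial q^i$, $[\![e_\alpha,e_\beta]\!]=\mathcal{C}^\gamma_{\alpha\beta}e_\gamma$. The exterior differential $\mathrm{d}^E:Sec(\bigwedge^kE^* )\to Sec(\bigwedge^{k+1}E^* )$ is $\mathrm{d}^E\mu(\sigma_1,\dots,\sigma_{k+1})=\sum_i(-1)^{i+1}\rho(\sigma_i)\mu(\dots,\widehat{\sigma_i},\dots)+\sum_{i<j}(-1)^{i+j}\mu([\![\sigma_i,\sigma_j]\!],\dots,\widehat{\sigma_i},\dots,\widehat{\sigma_j},\dots)$. A contact section on a Lie algebroid $A$ of rank $2k+1$ is a section $\eta$ of $A^*$ with $\eta\wedge(\mathrm{d}^A\eta)^k\neq0$ everywhere; its Reeb section is the unique section $\mathcal{R}$ of $A$ with $\imath_{\mathcal{R}}\mathrm{d}^A\eta=0$, $\imath_{\mathcal{R}}\eta=1$. Prolongations. For $P=E\times\mathbb{R}$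 or $P=E^*\times\mathbb{R}$ with projection $\pi:P\to Q$, $\mathcal{T}^EP\to P$ is the vector bundle with fibre over $p\in P$ equal to $\{(a,v)\in E_{\pi(p)}\times T_pP:\rho(a)=T\pi(v)\}$. Let $(q^i,y^\alpha,s)$ and $(q^i,y_\alpha,s)$ be the coordinates on $E\times\mathbb{R}$ and $E^*\times\mathbb{R}$ induced by $(q^i)$, $\{e_\alpha\}$ and its dual basis. A local basis of sections of $\mathcal{T}^E(E\times\mathbb{R})$ is $\mathcal{X}_\alpha=(e_\alpha,\rho^i_\alpha\,\partial/\partial q^i)$, $\mathcal{V}_\alpha=(0,\partial/\partial y^\alpha)$, $\mathcal{V}_s=(0,\partial/\partial s)$, and of $\mathcal{T}^E(E^*\times\mathbb{R})$ is $\widetilde{\mathcal{X}}_\alpha=(e_\alpha,\rho^i_\alpha\,\partial/\partial q^i)$, $\widetilde{\mathcal{V}}_\alpha=(0,\partial/\partial y_\alpha)$, $\widetilde{\mathcal{V}}_s=(0,\partial/\partial s)$; dual bases carry upper indices. Each $\mathcal{T}^EP$ is a Lie algebroid over $P$ with anchor $(a,v)\mapsto v$ (denoted $\rho^\pi$ for $P=E\times\mathbb{R}$, $\rho^{*\pi}$ for $P=E^*\times\mathbb{R}$) and bracket determined by $[\![\mathcal{X}_\alpha,\mathcal{X}_\beta]\!]=\mathcal{C}^\gamma_{\alpha\beta}\mathcal{X}_\gamma$ (resp. with tildes), all other brackets of basis sections being zero. $\mathrm{d}$ denotes the exterior differential of either; $\mathcal{V}^s=\mathrm{d}s$, $\widetilde{\mathcal{V}}^s=\mathrm{d}s$.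 Lagrangian side. Let $S(a_q,v_{(b_q,s)})=(0_q,(a_q)^V_{(b_q,s)})$ where $(a_q)^V_{(b_q,s)}f=\frac{d}{dt}|_{t=0}f(b_q+ta_q,s)$, and $\Delta(b_q,s)=(0_q,(b_q)^V_{(b_q,s)})$. Put $\Theta_L(b_q,s)(a_q,v)=[\rho^\pi(S(a_q,v))]L$, $\eta_L=\mathcal{V}^s-\Theta_L$ (locally $\mathcal{V}^s-\frac{\partial L}{\partial y^\alpha}\mathcal{X}^\alpha$), $E_L=\rho^\pi(\Delta)L-L$ (locally $y^\alpha\frac{\partial L}{\partial y^\alpha}-L$). $L$ is regular if $(\partial^2L/\partial y^\alpha\partial y^\beta)$ is non-singular everywhere; then $\eta_L$ is a contact section with Reeb section $\mathcal{R}_L$, and the Lagrangian section $\Gamma_L$ is the unique section of $\mathcal{T}^E(E\times\mathbb{R})$ with $\imath_{\Gamma_L}\eta_L=-E_L$, $\imath_{\Gamma_L}\mathrm{d}\eta_L=\mathrm{d}E_L-\rho^\pi(\mathcal{R}_L)(E_L)\eta_L$. The Herglotz equations for a curve $\widetilde c(t)=(q^i(t),y^\alpha(t),s(t))$ are $\frac{\mathrm{d}}{\mathrm{d}t}\big(\frac{\partial L}{\partial y^\alpha}\big)=\rho^i_\alpha\frac{\partial L}{\partial q^i}-y^\beta\mathcal{C}^\gamma_{\alpha\beta}\frac{\partial L}{\partial y^\gamma}+\frac{\partial L}{\partial y^\alpha}\frac{\partial L}{\partial s}$, $\frac{\mathrm{d}q^i}{\mathrm{d}t}=y^\alpha\rho^i_\alpha$,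 $\frac{\mathrm{d}s}{\mathrm{d}t}=L$ (along $\widetilde c$). Hamiltonian side. Let $\Theta_{(b^*_q,s)}(a_q,v)=b^*_q(a_q)$ and $\eta=\widetilde{\mathcal{V}}^s-\Theta$ (locally $\widetilde{\mathcal{V}}^s-y_\alpha\widetilde{\mathcal{X}}^\alpha$), a contact section of $\mathcal{T}^E(E^*\times\mathbb{R})$ with Reeb section $\mathcal{R}=\widetilde{\mathcal{V}}_s$. For $H:E^*\times\mathbb{R}\to\mathbb{R}$ the Hamiltonian section $\xi_H$ is the unique section of $\mathcal{T}^E(E^*\times\mathbb{R})$ with $\imath_{\xi_H}\eta=-H$, $\imath_{\xi_H}\mathrm{d}\eta=\mathrm{d}H-\rho^{*\pi}(\mathcal{R})(H)\eta$. The contact Hamilton equations for $\sigma(t)=(q^i(t),y_\alpha(t),s(t))$ are $\frac{\mathrm{d}q^i}{\mathrm{d}t}=\rho^i_\alpha\frac{\partial H}{\partial y_\alpha}$, $\frac{\mathrm{d}y_\alpha}{\mathrm{d}t}=-\big(\rho^i_\alpha\frac{\partial H}{\partial q^i}+\mathcal{C}^\gamma_{\alpha\beta}y_\gamma\frac{\partial H}{\partial y_\beta}+y_\alpha\frac{\partial H}{\partial s}\big)$, $\frac{\mathrm{d}s}{\mathrm{d}t}=y_\alpha\frac{\partial H}{\partial y_\alpha}-H$ (along $\sigma$). Legendre transformation. $\mathrm{Leg}_L:E\times\mathbb{R}\to E^*\times\mathbb{R}$, $\mathrm{Leg}_L(a_q,s)=(\mu_q(a_q,s),s)$ with $\mu_q(a_q,s)(b_q)=\frac{d}{dt}|_{t=0}L(a_q+tb_q,s)$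 for $b_q\in E_q$; locally $(q^i,y^\alpha,s)\mapsto(q^i,\partial L/\partial y^\alpha,s)$. $L$ is hyperregular if $\mathrm{Leg}_L$ is a global diffeomorphism (in particular $L$ is then regular). The induced map $\mathcal{T}^E\mathrm{Leg}_L:\mathcal{T}^E(E\times\mathbb{R})\to\mathcal{T}^E(E^*\times\mathbb{R})$ is $\mathcal{T}^E\mathrm{Leg}_L(a_q,v_{(b_q,s)})=(a_q,T_{(b_q,s)}\mathrm{Leg}_L(v_{(b_q,s)}))$. *)

(* Defs.v *)
From HB Require Import structures.
From mathcomp Require Import all_boot all_order all_algebra.
From mathcomp Require Import all_classical all_reals all_analysis.
Set Implicit Arguments.
Unset Strict Implicit.
Unset Printing Implicit Defensive.
Import Order.TTheory GRing.Theory Num.Theory.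
Import numFieldNormedType.Exports.
Local Open Scope classical_set_scope.
Local Open Scope ring_scope.

Section Calculus.
Context {R : realType} {V W : normedModType R}.

Fixpoint Ck (k : nat) (U : set V) (f : V -> W) : Prop :=
  match k with
  | 0%N => forall x, U x -> {for x, continuous f}
  | k'.+1 => (forall x, U x -> differentiable f x) /\
             (forall v, Ck k' U (fun x => 'D_v f x))
  end.

(* C^infinity on U, when U is open and V is finite-dimensional: in that case C^k.+1
   amounts to being differentiable with C^k directional derivatives. *)
Definition smooth_on (U : set V) (f : V -> W) : Prop := forall k, Ck k U f.

Definition smooth_near (x : V) (f : V -> W) : Prop :=
  exists2 U, open_nbhs x U & smooth_on U f.
End Calculus.

(* A chart with values in R^n. [cto] and [cfrom] are total functions which are
   only meaningful on [cdom] and on [cto @` cdom] respectively. *)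
Record chart (R : realType) (M : Type) (n : nat) := Chart {
  cdom : set M;
  cto : M -> 'rV[R]_n;
  cfrom : 'rV[R]_n -> M
}.

(* Tangent vectors are differential operators on functions M -> R. *)
Definition vop (R : realType) (M : Type) := (M -> R) -> R.

Section Atlas.
Context {R : realType} {M : Type} {n : nat}.
Variable A : set (chart R M n).

(* S contains a neighbourhood of p, for the topology induced by the atlas *)
Definition near_pt (p : M) (S : set M) : Prop :=
  forall k, A k -> cdom k p -> \forall x \near cto k p, S (cfrom k x).

Definition smooth_at (p : M) (f : M -> R) : Prop :=
  forall k, A k -> cdom k p -> smooth_near (cto k p) (f \o cfrom k).

Definition smooth_fun (f : M -> R) : Prop := forall p, smooth_at p f.

Definition coordf (k : chart R M n) (j : 'I_n) : M -> R :=
  fun p => cto k p 0 j.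

Definition partial (k : chart R M n) (j : 'I_n) (f : M -> R) (p : M) : R :=
  'D_(delta_mx 0 j) (f \o cfrom k) (cto k p).

(* The coordinate vector d/dx^j at p. Operators are sent to 0 on functions which
   are not smooth near p, so that a tangent vector is determined by its action
   on germs of smooth functions. *)
Definition cvec (k : chart R M n) (j : 'I_n) (p : M) : vop R M :=
  fun f => if `[< smooth_at p f >] then partial k j f p else 0.

Definition tangent (p : M) (v : vop R M) : Prop :=
  exists k (w : 'rV[R]_n),
    [/\ A k, cdom k p & v = \sum_(j < n) w 0 j *: cvec k j p].

Definition smooth_curve (I : set R) (g : R -> M) : Prop :=
  forall t, I t -> forall k, A k -> cdom k (g t) ->
    (\forall u \near t, cdom k (g u)) /\ smooth_near (t : R^o) (cto k \o g).
End Atlas.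

Definition smooth_map (R : realType) (M N : Type) (m n : nat)
    (A : set (chart R M m)) (B : set (chart R N n)) (F : M -> N) : Prop :=
  forall p k l, A k -> B l -> cdom k p -> cdom l (F p) ->
    near_pt A p (F @^-1` cdom l) /\
    smooth_near (cto k p) (cto l \o F \o cfrom k).

Definition diffeo_inverse (R : realType) (M N : Type) (m n : nat)
    (A : set (chart R M m)) (B : set (chart R N n))
    (F : M -> N) (G : N -> M) : Prop :=
  [/\ cancel F G, cancel G F, smooth_map A B F & smooth_map B A G].

(* T_pF v; B is the atlas of the target. *)
Definition tmap (R : realType) (M N : Type) (n : nat) (B : set (chart R N n))
    (F : M -> N) (p : M) (v : vop R M) : vop R N :=
  fun g => if `[< smooth_at B (F p) g >] then v (g \o F) else 0.

Section Manifold.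
Context {R : realType} {n : nat}.

Definition is_chart (M : topologicalType) (k : chart R M n) : Prop :=
  [/\ open (cdom k), open (cto k @` cdom k),
      (forall p, cdom k p -> cfrom k (cto k p) = p),
      (forall p, cdom k p -> {for p, continuous (cto k)}) &
      (forall x, (cto k @` cdom k) x -> {for x, continuous (cfrom k)})].

Definition chart_compat (M : Type) (k l : chart R M n) : Prop :=
  smooth_on (cto k @` (cdom k `&` cdom l)) (cto l \o cfrom k) /\
  smooth_on (cto l @` (cdom k `&` cdom l)) (cto k \o cfrom l).
End Manifold.

Record manifold (R : realType) (n : nat) := Manifold {
  msort :> topologicalType;
  matlas : set (chart R msort n);
  m_hausdorff : hausdorff_space msort;
  m_countable : @second_countable msort;
  m_chart : forall k, matlas k -> is_chart k;
  m_cover : forall p, exists2 k, matlas k & cdom k p;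
  m_compat : forall k l, matlas k -> matlas l -> chart_compat k l;
  m_maximal : forall k, is_chart k ->
    (forall l, matlas l -> chart_compat k l) -> matlas k
}.
Arguments matlas {R n} _ _.

(* A local frame; [fbas q] is only meaningful for q in [fdom]. *)
Record frame (R : realType) (Q : Type) (F : Q -> vectType R) (r : nat) := Frame {
  fdom : set Q;
  fbas : forall q, r.-tuple (F q)
}.

Section Frames.
Context {R : realType} {n : nat} (Q : manifold R n).
Context {F : Q -> vectType R} {r : nat}.

Definition is_frame (f : frame F r) : Prop :=
  open (fdom f) /\ forall q, fdom f q -> basis_of fullv (fbas f q).

Definition fcoord (f : frame F r) (a : 'I_r) (q : Q) (x : F q) : R :=
  coord (fbas f q) a x.

Definition frame_compat (f g : frame F r) : Prop :=
  forall q, fdom f q -> fdom g q -> forall a b,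
    smooth_at (matlas Q) q (fun q' => fcoord f b (tnth (fbas g q') a)) /\
    smooth_at (matlas Q) q (fun q' => fcoord g b (tnth (fbas f q') a)).
End Frames.

(* A smooth vector bundle of rank r, given by its fibres and its maximal atlas
   of smooth local frames (equivalently, of local trivialisations). *)
Record vbundle (R : realType) (n : nat) (Q : manifold R n) (r : nat) := VBundle {
  vfib :> Q -> vectType R;
  vframes : set (frame vfib r);
  vb_frame : forall f, vframes f -> is_frame f;
  vb_cover : forall q, exists2 f, vframes f & fdom f q;
  vb_compat : forall f g, vframes f -> vframes g -> frame_compat f g;
  vb_maximal : forall f, is_frame f ->
    (forall g, vframes g -> frame_compat f g) -> vframes f
}.

Section Sections.
Context {R : realType} {n : nat} {Q : manifold R n} {r : nat}.
Variable E : vbundle Q r.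

Definition smooth_section (s : forall q, E q) : Prop :=
  forall f, vframes f -> forall q, fdom f q -> forall a,
    smooth_at (matlas Q) q (fun q' => fcoord f a (s q')).

(* rho^i_a, for a bundle map rho from E to TQ *)
Definition anchor_coef (rho : forall q, E q -> vop R Q)
    (c : chart R Q n) (f : frame E r) (i : 'I_n) (a : 'I_r) (q : Q) : R :=
  rho q (tnth (fbas f q) a) (coordf c i).
End Sections.

(* The bracket is only constrained on smooth sections. *)
Record lie_algebroid (R : realType) (n : nat) (Q : manifold R n) (r : nat) :=
  LieAlgebroid {
  lbundle :> vbundle Q r;
  anchor : forall q, lbundle q -> vop R Q;
  br : (forall q, lbundle q) -> (forall q, lbundle q) -> forall q, lbundle q;
  anchor_tangent : forall q x, tangent (matlas Q) q (anchor (q := q) x);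
  anchor_linear : forall q k (x y : lbundle q),
    anchor (k *: x + y) = k *: anchor x + anchor y;
  anchor_smooth : forall c f, matlas Q c -> vframes f -> forall q,
    cdom c q -> fdom f q -> forall i a,
    smooth_at (matlas Q) q (anchor_coef anchor c f i a);
  br_smooth : forall s t, smooth_section s -> smooth_section t ->
    smooth_section (br s t);
  br_linear : forall k s1 s2 t,
    smooth_section s1 -> smooth_section s2 -> smooth_section t ->
    forall q, br (fun q' => k *: s1 q' + s2 q') t q = k *: br s1 t q + br s2 t q;
  br_anti : forall s t, smooth_section s -> smooth_section t ->
    forall q, br s t q = - br t s q;
  br_jacobi : forall s t u,
    smooth_section s -> smooth_section t -> smooth_section u ->
    forall q, br s (br t u) q + br t (br u s) q + br u (br s t) q = 0;
  br_leibniz : forall s t g,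
    smooth_section s -> smooth_section t -> smooth_fun (matlas Q) g ->
    forall q, br s (fun q' => g q' *: t q') q =
              g q *: br s t q + anchor (s q) g *: t q
}.

Section StructureFunctions.
Context {R : realType} {n : nat} {Q : manifold R n} {r : nat}.
Variable E : lie_algebroid Q r.

(* A global smooth section with the same germ at q as the local section s; it
   exists by means of bump functions whenever s is smooth near q. *)
Definition germ_ext (q : Q) (s : forall q, E q) : forall q, E q :=
  match pselect (exists s', smooth_section s' /\
                            \forall q' \near q, s' q' = s q') with
  | left ex => projT1 (cid ex)
  | right _ => s
  end.

(* The bracket of sections is a local operator, hence extends to local sections
   (such as those of a local frame), independently of the chosen extensions. *)
Definition local_br (s t : forall q, E q) (q : Q) : E q :=
  br (germ_ext q s) (germ_ext q t) q.

(* C^g_{ab} *)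
Definition strf (f : frame E r) (a b g : 'I_r) (q : Q) : R :=
  fcoord f g (local_br (fun q' => tnth (fbas f q') a)
                       (fun q' => tnth (fbas f q') b) q).

(* rho^i_a *)
Definition rhof (c : chart R Q n) (f : frame E r) : 'I_n -> 'I_r -> Q -> R :=
  anchor_coef (@anchor _ _ _ _ E) c f.
End StructureFunctions.

(* The total space of F x R, for F a family of vector spaces over Q. *)
Definition totR (R : realType) (Q : Type) (F : Q -> vectType R) : Type :=
  ({q : Q & F q} * R)%type.

Section Total.
Context {R : realType} {n : nat} {Q : manifold R n}.
Context {F : Q -> vectType R} {r : nat}.

Definition bproj (p : totR F) : Q := tag p.1.

Definition fibre (p : totR F) : F (bproj p) := tagged p.1.

Definition mkpt (q : Q) (x : F q) (s : R) : totR F := (Tagged F x, s).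

(* The chart (q^i, y^a, s) of F x R *)
Definition tot_chart (c : chart R Q n) (f : frame F r) :
    chart R (totR F) (n + r + 1) :=
  {| cdom := [set p | cdom c (bproj p) /\ fdom f (bproj p)];
     cto := fun p => row_mx (row_mx (cto c (bproj p))
                                    (\row_a fcoord f a (fibre p)))
                            (\row_(_ < 1) p.2);
     cfrom := fun x =>
       let q := cfrom c (lsubmx (lsubmx x)) in
       mkpt (\sum_a (rsubmx (lsubmx x)) 0 a *: tnth (fbas f q) a)
            (rsubmx x 0 0) |}.

Definition qI (i : 'I_n) : 'I_(n + r + 1) := lshift 1 (lshift r i).
Definition yI (a : 'I_r) : 'I_(n + r + 1) := lshift 1 (rshift n a).
Definition sI : 'I_(n + r + 1) := rshift (n + r) ord0.

Definition tot_vlift (A : set (chart R (totR F) (n + r + 1)))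
    (p : totR F) (x : F (bproj p)) : vop R (totR F) :=
  fun g => if `[< smooth_at A p g >]
           then derive1 (fun t : R => g (mkpt (fibre p + t *: x) p.2) : R^o) 0
           else 0.
End Total.

Section Dual.
Context {R : realType} {n : nat} {Q : manifold R n} {r : nat}.

Definition dual (F : Q -> vectType R) : Q -> vectType R :=
  fun q => 'Hom(F q, R^o).

Definition dual_frame (F : Q -> vectType R) (f : frame F r) : frame (dual F) r :=
  @Frame R Q (dual F) r (fdom f)
    (fun q => [tuple linfun (fun x : F q => fcoord f a x : R^o) | a < r]).
End Dual.

(* The prolongation T^E P of E over P = F x R, where g turns frames of E into
   frames of F: either F = E and g is the identity, or F = E^* and g f is the
   frame dual to f. *)
Section Prolongation.
Context {R : realType} {n : nat} {Q : manifold R n} {r : nat}.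
Variable E : lie_algebroid Q r.
Context {F : Q -> vectType R}.
Variable g : frame E r -> frame F r.

Notation P := (totR F).

Definition tot_atlas : set (chart R P (n + r + 1)) :=
  [set k | exists c f, [/\ matlas Q c, vframes f & k = tot_chart c (g f)]].

(* (c, f) gives a coordinate system (q^i), (e_a) around the projection of p *)
Definition adapted (c : chart R Q n) (f : frame E r) (p : P) : Prop :=
  [/\ matlas Q c, vframes f, cdom c (bproj p) & fdom f (bproj p)].

(* Pairs (a, v); the fibre of T^E P at p is the set of those satisfying
   [in_prol]. The anchor of T^E P is the second projection. *)
Definition prolT (p : P) : Type := (E (bproj p) * vop R P)%type.

Definition in_prol (p : P) (z : prolT p) : Prop :=
  tangent tot_atlas p z.2 /\ anchor z.1 = tmap (matlas Q) bproj p z.2.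

Definition Xsec (c : chart R Q n) (f : frame E r) (a : 'I_r) (p : P) : prolT p :=
  (tnth (fbas f (bproj p)) a,
   \sum_(i < n) rhof c f i a (bproj p) *:
      cvec tot_atlas (tot_chart c (g f)) (qI i) p).

Definition Vsec (c : chart R Q n) (f : frame E r) (a : 'I_r) (p : P) : prolT p :=
  (0, cvec tot_atlas (tot_chart c (g f)) (yI a) p).

Definition Vs_sec (c : chart R Q n) (f : frame E r) (p : P) : prolT p :=
  (0, cvec tot_atlas (tot_chart c (g f)) sI p).

(* The components of z in the basis (Xsec, Vsec, Vs_sec) are the [Xcomp f a z],
   the [vcomp c f (yI a) z] and [vcomp c f sI z]: the vector part of Xsec has no
   component along d/dy and d/ds. *)
Definition Xcomp (f : frame E r) (a : 'I_r) (z : forall p, prolT p) : P -> R :=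
  fun p => fcoord f a (z p).1.

Definition vcomp (c : chart R Q n) (f : frame E r) (j : 'I_(n + r + 1))
    (z : forall p, prolT p) : P -> R :=
  fun p => (z p).2 (coordf (tot_chart c (g f)) j).

Definition prol_section_near (p : P) (z : forall p, prolT p) : Prop :=
  near_pt tot_atlas p [set p' | in_prol (z p')] /\
  forall c f, adapted c f p ->
    (forall a, smooth_at tot_atlas p (Xcomp f a z)) /\
    (forall j, smooth_at tot_atlas p (vcomp c f j z)).

Definition prol_section (z : forall p, prolT p) : Prop :=
  (forall p, in_prol (z p)) /\ (forall p, prol_section_near p z).

(* The bracket of (local) sections of T^E P, computed near p in the basis given
   by (c, f): this is the Leibniz extension of
   [[X_a, X_b]] = C^g_{ab} X_g, all other brackets of basis sections being 0. *)
Definition prol_br (c : chart R Q n) (f : frame E r)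
    (z w : forall p, prolT p) (p : P) : prolT p :=
  \sum_(d < r) ((z p).2 (Xcomp f d w) - (w p).2 (Xcomp f d z)
     + \sum_(a < r) \sum_(b < r)
          Xcomp f a z p * Xcomp f b w p * strf f a b d (bproj p)) *: Xsec c f d p
  + \sum_(a < r) ((z p).2 (vcomp c f (yI a) w)
                  - (w p).2 (vcomp c f (yI a) z)) *: Vsec c f a p
  + ((z p).2 (vcomp c f sI w) - (w p).2 (vcomp c f sI z)) *: Vs_sec c f p.

(* d(eta)(z, w) at p, for a section eta of the dual of T^E P *)
Definition dform (c : chart R Q n) (f : frame E r)
    (eta : forall p, prolT p -> R) (z w : forall p, prolT p) (p : P) : R :=
  (z p).2 (fun p' => eta p' (w p')) - (w p).2 (fun p' => eta p' (z p'))
  - eta p (prol_br c f z w p).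

(* Equalities of sections of the dual of T^E P are tested, at each p, on all
   sections w defined near p; the value of [dform] at p does not depend on the
   adapted coordinates. *)
Definition is_reeb (eta : forall p, prolT p -> R) (z : forall p, prolT p) : Prop :=
  prol_section z /\
  forall p,
    (forall c f w, adapted c f p -> prol_section_near p w ->
       dform c f eta z w p = 0) /\
    eta p (z p) = 1.

(* i_z eta = - h and i_z d(eta) = dh - rho(reeb)(h) eta *)
Definition is_hamiltonian_section (eta : forall p, prolT p -> R)
    (reeb : forall p, prolT p) (h : P -> R) (z : forall p, prolT p) : Prop :=
  prol_section z /\
  forall p,
    eta p (z p) = - h p /\
    forall c f w, adapted c f p -> prol_section_near p w ->
      dform c f eta z w p = (w p).2 h - (reeb p).2 h * eta p (w p).

Definition ds (p : P) (z : prolT p) : R := z.2 snd.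
End Prolongation.

Section Lagrangian.
Context {R : realType} {n : nat} {Q : manifold R n} {r : nat}.
Variable E : lie_algebroid Q r.

Definition atlasE : set (chart R (totR E) (n + r + 1)) := tot_atlas (E := E) id.

Definition SE (p : totR E) (z : prolT E p) : prolT E p :=
  (0, tot_vlift atlasE z.1).

Definition DeltaE (p : totR E) : prolT E p :=
  (0, tot_vlift atlasE (fibre p)).

Variable L : totR E -> R.

Definition ThetaL (p : totR E) (z : prolT E p) : R := (SE z).2 L.

Definition etaL (p : totR E) (z : prolT E p) : R := ds z - ThetaL z.

Definition energy (p : totR E) : R := (DeltaE p).2 L - L p.

Definition lagrangian_section (reebL Gam : forall p : totR E, prolT E p) : Prop :=
  is_hamiltonian_section id etaL reebL energy Gam.

Definition herglotz (I : set R) (gam : R -> totR E) : Prop :=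
  smooth_curve atlasE I gam /\
  forall t, I t -> forall c f, adapted c f (gam t) ->
    let k := tot_chart c f in
    let q := bproj (gam t) in
    let y a := coordf k (yI a) (gam t) in
    let dq i := partial k (qI i) L (gam t) in
    let dy a := partial k (yI a) L (gam t) in
    let dLs := partial k sI L (gam t) in
    [/\ forall a, is_derive (t : R^o) 1
          (fun u : R^o => partial k (yI a) L (gam u) : R^o)
          (\sum_i rhof c f i a q * dq i
           - \sum_b \sum_d y b * strf f a b d q * dy d
           + dy a * dLs),
        forall i, is_derive (t : R^o) 1
          (fun u : R^o => coordf k (qI i) (gam u) : R^o)
          (\sum_a y a * rhof c f i a q) &
        is_derive (t : R^o) 1 (fun u : R^o => coordf k sI (gam u) : R^o)
          (L (gam t))].

Definition legendre_fibre (p : totR E) : dual E (bproj p) :=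
  linfun (fun b : E (bproj p) =>
    derive1 (fun t : R => L (mkpt (fibre p + t *: b) p.2) : R^o) 0).

Definition legendre (p : totR E) : totR (dual E) := mkpt (legendre_fibre p) p.2.
End Lagrangian.

Section Hamiltonian.
Context {R : realType} {n : nat} {Q : manifold R n} {r : nat}.
Variable E : lie_algebroid Q r.

Definition atlasEd : set (chart R (totR (dual E)) (n + r + 1)) :=
  tot_atlas (E := E) (@dual_frame _ _ _ _ E).

Definition Theta_can (p : totR (dual E)) (z : prolT E p) : R := fibre p z.1.

Definition eta_can (p : totR (dual E)) (z : prolT E p) : R := ds z - Theta_can z.

Variable H : totR (dual E) -> R.

Definition hamiltonian_section (reeb xi : forall p : totR (dual E), prolT E p) :
    Prop :=
  is_hamiltonian_section (@dual_frame _ _ _ _ E) eta_can reeb H xi.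

Definition hamilton (I : set R) (sig : R -> totR (dual E)) : Prop :=
  smooth_curve atlasEd I sig /\
  forall t, I t -> forall c f, adapted (E := E) c f (sig t) ->
    let k := tot_chart c (dual_frame f) in
    let q := bproj (sig t) in
    let y a := coordf k (yI a) (sig t) in
    let dq i := partial k (qI i) H (sig t) in
    let dy a := partial k (yI a) H (sig t) in
    let dHs := partial k sI H (sig t) in
    [/\ forall i, is_derive (t : R^o) 1
          (fun u : R^o => coordf k (qI i) (sig u) : R^o)
          (\sum_a rhof c f i a q * dy a),
        forall a, is_derive (t : R^o) 1
          (fun u : R^o => coordf k (yI a) (sig u) : R^o)
          (- (\sum_i rhof c f i a q * dq i
              + \sum_b \sum_d strf f a b d q * y d * dy b
              + y a * dHs)) &
        is_derive (t : R^o) 1 (fun u : R^o => coordf k sI (sig u) : R^o)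
          (\sum_a y a * dy a - H (sig t))].
End Hamiltonian.

(* L is hyperregular: Leg_L is a global diffeomorphism, with inverse Leginv. *)
Definition hyperregular (R : realType) (n : nat) (Q : manifold R n) (r : nat)
    (E : lie_algebroid Q r) (L : totR E -> R)
    (Leginv : totR (dual E) -> totR E) : Prop :=
  diffeo_inverse (atlasE (E := E)) (atlasEd (E := E)) (legendre L) Leginv.

Definition prol_legendre (R : realType) (n : nat) (Q : manifold R n) (r : nat)
    (E : lie_algebroid Q r) (L : totR E -> R) (p : totR E) (z : prolT E p) :
    prolT E (legendre L p) :=
  (z.1, tmap (atlasEd (E := E)) (legendre L) p z.2).

(* Main.v *)
Require Import Defs.
From HB Require Import structures.
From mathcomp Require Import all_boot all_order all_algebra.
From mathcomp Require Import all_classical all_reals all_analysis ring.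
Set Implicit Arguments.
Unset Strict Implicit.
Unset Printing Implicit Defensive.
Import Order.TTheory GRing.Theory Num.Theory.
Import numFieldNormedType.Exports.
Local Open Scope classical_set_scope.
Local Open Scope ring_scope.

(** The two dynamical sections are characterised by the same kind of equations.
    In adapted coordinates both contact forms read eta = ds - theta_a X^a, with
    theta_a = dL/dy^a on E x R and theta_a = y_a on E^* x R, and the Leibniz
    rule gives, for sections z, w with X-components Z^a, W^a,
      d(eta)(z, w) = w(theta_a) Z^a - z(theta_a) W^a + theta_d C^d_ab Z^a W^b
    ([dform_theta]).  The Legendre transformation pulls y_a back to dL/dy^a,
    fixes q and s, and pulls H back to E_L, so the prolonged map carries each
    term of the equation of Gamma_L to the corresponding term of the equation
    of xi_H.  Subtracting the two equations at a point, and testing on all w,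
    shows that T Leg (Gamma_L) and xi_H have the same components
    ([contact_pairing_inj]); this uses only that the differential of Leg_L is
    surjective ([dlegendre_surj]), which follows from Leg_L having a smooth
    inverse, so no Hessian has to be inverted.  The test vectors are realised
    by sections with constant components in an adapted frame
    ([const_sec_section]).

    For the curves, differentiating H o Leg_L = E_L = y^a dL/dy^a - L, the
    terms in dy^a cancel and what remains is
      dH (w) = y^a w_a - dL/dq^i w^i - dL/ds w_s   at Leg_L p
    for each w in the image of the differential of Leg_L ([tvec_H]), that is
    for each w.  Hence dH/dy_a = y^a, dH/dq^i = - dL/dq^i and
    dH/ds = - dL/ds, which turns the Herglotz equations for a curve into the
    contact Hamilton equations for its image, one equation at a time
    ([herglotz_iff_hamilton]).

    The preparatory parts show that the coordinate calculus is legitimate: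
    smooth functions are closed under the usual operations, smoothness and
    neighbourhoods can be tested in a single chart, and tangent vectors, which
    are operators on functions, act as directional derivatives in each chart
    ([tangentE]). *)

(** * Calculus of smooth functions *)

Section Calculus.
Context {R : realType}.
Implicit Types V W X : normedModType R.

(** The expansion of f at x is also one of g, since they differ only away from
    x; by uniqueness of the differential, [near_eq_diff] follows. *)
Lemma near_eq_diff_locally V W (f g : V -> W) (x : V) :
  (\near x, f x = g x) -> differentiable f x ->
  g \o shift x = cst (g x) + 'd f x +o_ 0 id.
Proof.
move=> fg /diff_locally /eqaddoP df; apply/eqaddoP => e e0.
have fgx : f x = g x by exact: nbhs_singleton fg.
have fg0 : \forall h \near (0 : V), f (h + x) = g (h + x).
  move: fg; rewrite (near_shift 0) => fg.
  by apply: filterS fg => h /=; rewrite /shift /= subr0.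
near=> h.
have -> : (g \o shift x - (cst (g x) + 'd f x)) h =
   (f \o shift x - (cst (f x) + 'd f x)) h.
  rewrite !fctE /shift /= -fgx; congr (_ - _).
  by apply/esym; near: h.
by near: h; exact: df.
Unshelve. all: by end_near. Qed.

Lemma near_eq_diff V W (f g : V -> W) (x : V) :
  (\near x, f x = g x) -> differentiable f x -> 'd g x = 'd f x :> (V -> W).
Proof.
move=> fg df; apply: diff_unique; first exact: diff_continuous.
exact: near_eq_diff_locally.
Qed.

Lemma near_eq_differentiable V W (f g : V -> W) (x : V) :
  (\near x, f x = g x) -> differentiable f x -> differentiable g x.
Proof.
move=> fg df; apply/diff_locallyP; rewrite (near_eq_diff fg df); split.
  exact: diff_continuous.
exact: near_eq_diff_locally.
Qed.

Lemma near_eq_diffE V W (f g : V -> W) (x v : V) :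
  (\near x, f x = g x) -> differentiable f x -> 'd g x v = 'd f x v.
Proof. by move=> fg df; have -> := near_eq_diff fg df. Qed.

Lemma diff_compE V W X (f : V -> W) (g : W -> X) (x v : V) :
  differentiable f x -> differentiable g (f x) ->
  'd (g \o f) x v = 'd g (f x) ('d f x v).
Proof. by move=> df dg; have -> := diff_comp df dg. Qed.

Lemma CkS k V W (U : set V) (f : V -> W) :
  Ck k.+1 U f = ((forall x, U x -> differentiable f x) /\
                 (forall v, Ck k U (fun x => 'D_v f x))).
Proof. by []. Qed.

Lemma Ck0 V W (U : set V) (f : V -> W) :
  Ck 0 U f = (forall x, U x -> {for x, continuous f}).
Proof. by []. Qed.

Lemma Ck_eq k V W (U : set V) (f g : V -> W) : open U ->
  (forall x, U x -> f x = g x) -> Ck k U f -> Ck k U g.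
Proof.
move=> oU; elim: k f g => [|k IH] f g fg; rewrite ?Ck0 ?CkS.
  move=> cf x Ux.
  have fgx : \near x, f x = g x.
    by apply: filterS (open_nbhs_nbhs (conj oU Ux)) => y /fg.
  rewrite /prop_for /continuous_at -(fg _ Ux).
  by apply: cvg_trans (cf x Ux); apply: near_eq_cvg; exact: fgx.
have fgx x : U x -> \near x, f x = g x.
  by move=> Ux; apply: filterS (open_nbhs_nbhs (conj oU Ux)) => y /fg.
move=> [df Df]; split=> [x Ux|v].
  by apply: near_eq_differentiable (df x Ux); exact: fgx.
by apply: IH (Df v) => x Ux; apply: near_eq_derive; exact: fgx.
Qed.

Lemma Ck_sub k V W (U U' : set V) (f : V -> W) :
  U' `<=` U -> Ck k U f -> Ck k U' f.
Proof.
move=> U'U; elim: k f => [|k IH] f; rewrite ?Ck0 ?CkS.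
  by move=> cf x /U'U /cf.
by move=> [df Df]; split=> [x /U'U /df|v] //; exact/IH/Df.
Qed.

Lemma CkW k V W (U : set V) (f : V -> W) : Ck k.+1 U f -> Ck k U f.
Proof.
elim: k f => [|k IH] f; rewrite ?Ck0 ?CkS.
  by move=> [df _] x /df; exact: differentiable_continuous.
by move=> [df Df]; split=> // v; exact/IH/Df.
Qed.

Lemma Ck_cst k V W (U : set V) (a : W) : Ck k U (cst a : V -> W).
Proof.
elim: k a => [|k IH] a; rewrite ?Ck0 ?CkS.
  by move=> x _; exact: cst_continuous.
split=> [x _|v]; first exact: differentiable_cst.
rewrite (_ : (fun x => _) = cst 0); first exact: IH.
by apply/funext => x; rewrite derive_cst.
Qed.

Lemma CkD k V W (U : set V) (f g : V -> W) : open U ->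
  Ck k U f -> Ck k U g -> Ck k U (fun x => f x + g x).
Proof.
move=> oU; elim: k f g => [|k IH] f g; rewrite ?Ck0 ?CkS.
  by move=> cf cg x Ux; apply: continuousD; [exact: cf|exact: cg].
move=> [df Df] [dg Dg]; split=> [x Ux|v].
  by apply: differentiableD; [exact: df|exact: dg].
apply: (@Ck_eq _ _ _ _ (fun x => 'D_v f x + 'D_v g x)) => // [x Ux|].
  by rewrite deriveD //; apply: diff_derivable; [exact: df|exact: dg].
exact: IH.
Qed.

Lemma CkM k V (U : set V) (f g : V -> R) : open U ->
  Ck k U f -> Ck k U g -> Ck k U (fun x => f x * g x).
Proof.
move=> oU; elim: k f g => [|k IH] f g.
  rewrite !Ck0 => cf cg x Ux; apply: continuousM; [exact: cf|exact: cg].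
move=> Cf Cg; move: (Cf) (Cg); rewrite !CkS => -[df Df] [dg Dg]; split=> [x Ux|v].
  by apply: differentiableM; [exact: df|exact: dg].
apply: (@Ck_eq _ _ _ _ (fun x => f x * 'D_v g x + g x * 'D_v f x)) => // [x Ux|].
  by rewrite deriveM //; apply: diff_derivable; [exact: df|exact: dg].
by apply: CkD => //; apply: IH => //; exact: CkW.
Qed.

Lemma Ck_Zl k V W (U : set V) (f : V -> R) (w : W) : open U ->
  Ck k U f -> Ck k U (fun x => f x *: w).
Proof.
move=> oU; elim: k f => [|k IH] f; rewrite ?Ck0 ?CkS.
  move=> cf x Ux; apply: (@continuous_comp _ _ _ f ( *:%R^~ w)).
    exact: cf.
  exact: scalel_continuous.
move=> [df Df]; split=> [x Ux|v].
  by apply: differentiableZl; exact: df.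
apply: (@Ck_eq _ _ _ _ (fun x => 'D_v f x *: w)) => // [x Ux|]; last exact: IH.
rewrite !deriveE ?diffZl //; try exact: df.
by apply: differentiableZl; exact: df.
Qed.

Lemma Ck_sum k V W (I : Type) (s : seq I) (P : pred I) (U : set V)
    (f : I -> V -> W) : open U ->
  (forall i, P i -> Ck k U (f i)) -> Ck k U (fun x => \sum_(i <- s | P i) f i x).
Proof.
move=> oU Cf; elim: s => [|i s IH].
  by under eq_fun do rewrite big_nil; exact: Ck_cst.
under eq_fun do rewrite big_cons.
by case: (boolP (P i)) => // Pi; apply: CkD => //; exact: Cf.
Qed.

Lemma derive_coord V m (f : V -> 'rV[R]_m) x v j :
  differentiable f x -> 'D_v (fun y => f y 0 j) x = ('D_v f x) 0 j.
Proof.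
move=> df; pose g (y : 'rV[R]_m) : R := y 0 j.
have dg y : differentiable g y by exact: differentiable_coord.
rewrite -[fun y => _]/(g \o f) deriveE; last exact: differentiable_comp.
rewrite diff_comp // deriveE //=.
have glin : linear g by move=> a u w; rewrite /g !mxE.
pose glM := GRing.isLinear.Build _ _ _ _ _ glin.
pose l : {linear _ -> _} := HB.pack g glM.
by rewrite -[g]/(l : _ -> _) diff_lin //; exact: coord_continuous.
Qed.

Lemma differentiable_coordP V m (f : V -> 'rV[R]_m) x :
  differentiable f x <-> forall j, differentiable (fun y => f y 0 j) x.
Proof.
split=> [df j|df].
  apply: (@differentiable_comp _ _ _ _ f (fun y : 'rV[R]_m => y 0 j)) => //.
  exact: differentiable_coord.
rewrite (_ : f = \sum_j (fun y => f y 0 j *: delta_mx 0 j)).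
  by apply: differentiable_sum => j; exact: differentiableZl.
apply/funext => y; rewrite fct_sumE [LHS]row_sum_delta.
by apply: eq_bigr.
Qed.

Lemma Ck_coord k V m (U : set V) (f : V -> 'rV[R]_m) j : open U ->
  Ck k U f -> Ck k U (fun x => f x 0 j).
Proof.
move=> oU; elim: k f => [|k IH] f; rewrite ?Ck0 ?CkS.
  move=> cf x Ux; apply: (@continuous_comp _ _ _ f (fun y : 'rV[R]_m => y 0 j)).
    exact: cf.
  exact: coord_continuous.
move=> [df Df]; split=> [x Ux|v].
  by have /differentiable_coordP := df x Ux; apply.
apply: (@Ck_eq _ _ _ _ (fun x => ('D_v f x) 0 j)) => // [x Ux|]; last exact: IH.
by rewrite derive_coord //; exact: df.
Qed.

Lemma diff_row_sum m W (f : 'rV[R]_m -> W) x v :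
  'd f x v = \sum_j v 0 j *: 'd f x (delta_mx 0 j).
Proof.
rewrite {1}(row_sum_delta v) linear_sum.
by apply: eq_bigr => j _; rewrite linearZ.
Qed.

(** The chain rule in the form needed to iterate it: a derivative of g o f is a
    sum of products of derivatives of f with derivatives of g composed with f. *)
Lemma derive_comp V m W (f : V -> 'rV[R]_m) (g : 'rV[R]_m -> W) x v :
  differentiable f x -> differentiable g (f x) ->
  'D_v (g \o f) x = \sum_j ('D_v f x) 0 j *: 'D_(delta_mx 0 j) g (f x).
Proof.
move=> df dg; have dgf : differentiable (g \o f) x by exact: differentiable_comp.
rewrite (deriveE v dgf) diff_compE // [LHS]diff_row_sum.
by apply: eq_bigr => j _; rewrite (deriveE _ dg) (deriveE _ df).
Qed.

(** By [derive_comp], a derivative of g o f is built by sums and products from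
    functions that are C^k, using the induction hypothesis for the partial
    derivatives of g composed with f. *)
Lemma Ck_comp_scalar k V m (U : set V) (U' : set 'rV[R]_m) (f : V -> 'rV[R]_m)
    (g : 'rV[R]_m -> R) : open U ->
  (forall x, U x -> U' (f x)) -> Ck k U f -> Ck k U' g -> Ck k U (g \o f).
Proof.
move=> oU fU; elim: k f g fU => [|k IH] f g fU.
  rewrite !Ck0 => cf cg x Ux.
  by apply: continuous_comp; [exact: cf|exact: (cg _ (fU _ Ux))].
move=> Cf Cg; move: (Cf) (Cg); rewrite !CkS => -[df Df] [dg Dg]; split=> [x Ux|v].
  by apply: differentiable_comp; [exact: df|exact: (dg _ (fU _ Ux))].
apply: (@Ck_eq _ _ _ _
  (fun x => \sum_j ('D_v f x) 0 j * 'D_(delta_mx 0 j) g (f x))) => // [x Ux|].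
  by rewrite derive_comp //; [exact: df|exact: (dg _ (fU _ Ux))].
apply: Ck_sum => // j _; apply: CkM => //; first exact: Ck_coord.
by apply: (IH f (fun y => 'D_(delta_mx 0 j) g y)) => //; exact: CkW.
Qed.

Lemma Ck_id k V (U : set V) : Ck k U (@id V).
Proof.
case: k => [|k]; first by rewrite Ck0 => x _; exact: cvg_id.
rewrite CkS; split=> [x _|v] //.
rewrite (_ : (fun x => _) = cst v); first exact: Ck_cst.
by apply/funext => x; rewrite derive_id.
Qed.

Lemma smooth_near_nbhs V W (x : V) (S : set V) (f : V -> W) :
  nbhs x S -> smooth_on S f -> smooth_near x f.
Proof.
move=> Sx Sf; exists S°.
  by split; [exact: open_interior|exact: Sx].
by move=> k; apply: Ck_sub (Sf k); exact: interior_subset.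
Qed.

Lemma smooth_near_eq V W (x : V) (f g : V -> W) :
  (\forall y \near x, f y = g y) -> smooth_near x f -> smooth_near x g.
Proof.
move=> fg [U [oU Ux] Uf].
have [B [oB Bx] BE] : exists2 B, open_nbhs x B & B `<=` [set y | f y = g y].
  by move: fg; rewrite /prop_near1 nbhsE.
exists (U `&` B); first by split; [exact: openI|].
move=> k; apply: (@Ck_eq k _ _ _ f); first exact: openI.
  by move=> y [_ /BE].
by apply: Ck_sub (Uf k) => y [].
Qed.

Lemma smooth_near_differentiable V W (x : V) (f : V -> W) :
  smooth_near x f -> differentiable f x.
Proof. by move=> [U [oU Ux] /(_ 1%N)]; rewrite CkS => -[/(_ x Ux)]. Qed.

Lemma smooth_near_continuous V W (x : V) (f : V -> W) :
  smooth_near x f -> {for x, continuous f}.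
Proof. by move/smooth_near_differentiable/differentiable_continuous. Qed.

Lemma smooth_near_near V W (x : V) (f : V -> W) :
  smooth_near x f -> \forall y \near x, smooth_near y f.
Proof.
move=> [U [oU Ux] Uf]; apply: filterS (open_nbhs_nbhs (conj oU Ux)) => y Uy.
by exists U.
Qed.

Lemma smooth_near_derive V W (x v : V) (f : V -> W) :
  smooth_near x f -> smooth_near x (fun y => 'D_v f y).
Proof.
move=> [U Ux Uf]; exists U => // k.
by move: (Uf k.+1); rewrite CkS => -[_]; apply.
Qed.

Lemma smooth_near_cst V W (x : V) (a : W) : smooth_near x (cst a).
Proof. by exists setT; [exact: open_nbhsT|move=> k; exact: Ck_cst]. Qed.

Lemma smooth_near_id V (x : V) : smooth_near x (@id V).
Proof. by exists setT; [exact: open_nbhsT|move=> k; exact: Ck_id]. Qed.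

Lemma smooth_nearD V W (x : V) (f g : V -> W) :
  smooth_near x f -> smooth_near x g -> smooth_near x (fun y => f y + g y).
Proof.
move=> [U [oU Ux] Uf] [U' [oU' U'x] Ug]; have oI := openI oU oU'.
exists (U `&` U') => // k; apply: CkD => //.
  by apply: Ck_sub (Uf k) => y [].
by apply: Ck_sub (Ug k) => y [].
Qed.

Lemma smooth_nearM V (x : V) (f g : V -> R) :
  smooth_near x f -> smooth_near x g -> smooth_near x (fun y => f y * g y).
Proof.
move=> [U [oU Ux] Uf] [U' [oU' U'x] Ug]; have oI := openI oU oU'.
exists (U `&` U') => // k; apply: CkM => //.
  by apply: Ck_sub (Uf k) => y [].
by apply: Ck_sub (Ug k) => y [].
Qed.

Lemma smooth_nearZl V W (x : V) (f : V -> R) (w : W) :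
  smooth_near x f -> smooth_near x (fun y => f y *: w).
Proof. by move=> [U [oU Ux] Uf]; exists U => // k; exact: Ck_Zl. Qed.

Lemma smooth_near_sum V W (x : V) (I : Type) (s : seq I) (P : pred I)
    (f : I -> V -> W) :
  (forall i, P i -> smooth_near x (f i)) ->
  smooth_near x (fun y => \sum_(i <- s | P i) f i y).
Proof.
move=> Sf; elim: s => [|i s IH].
  by under eq_fun do rewrite big_nil; exact: smooth_near_cst.
under eq_fun do rewrite big_cons.
by case: (boolP (P i)) => // Pi; apply: smooth_nearD => //; exact: Sf.
Qed.

Lemma smooth_near_rowP V m (x : V) (f : V -> 'rV[R]_m) :
  smooth_near x f <-> forall j, smooth_near x (fun y => f y 0 j).
Proof.
split=> [[U [oU Ux] Uf] j|Sf]; first by exists U => // k; exact: Ck_coord.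
rewrite (_ : f = fun y => \sum_j f y 0 j *: delta_mx 0 j).
  by apply: smooth_near_sum => j _; exact: smooth_nearZl.
by apply/funext => y; exact: row_sum_delta.
Qed.

Lemma smooth_near_comp_scalar V m (x : V) (f : V -> 'rV[R]_m)
    (g : 'rV[R]_m -> R) :
  smooth_near x f -> smooth_near (f x) g -> smooth_near x (g \o f).
Proof.
move=> Sf; have cf := smooth_near_continuous Sf.
move: Sf => [U [oU Ux] Uf] [U' [oU' U'x] Ug].
pose S := U `&` f @^-1` U'.
have Sx : nbhs x S.
  apply: filterI; first exact: open_nbhs_nbhs.
  by apply: cf; exact: open_nbhs_nbhs.
(* S contains x in its interior, but need not be open itself *)
exists S°; first by split; [exact: open_interior|].
move=> k; apply: (@Ck_comp_scalar _ _ _ _ U') => //; first exact: open_interior.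
  by move=> y /interior_subset[].
by apply: Ck_sub (Uf k) => y /interior_subset[].
Qed.

Lemma smooth_near_comp V m l (x : V) (f : V -> 'rV[R]_m)
    (g : 'rV[R]_m -> 'rV[R]_l) :
  smooth_near x f -> smooth_near (f x) g -> smooth_near x (g \o f).
Proof.
move=> Sf /smooth_near_rowP Sg; apply/smooth_near_rowP => j.
exact: (@smooth_near_comp_scalar _ _ _ f (fun y => g y 0 j)).
Qed.

Lemma smooth_nearN V (x : V) (f : V -> R) :
  smooth_near x f -> smooth_near x (fun y => - f y).
Proof.
move=> Sf; have -> : (fun y => - f y) = (fun y => (cst (-1) : V -> R) y * f y).
  by apply/funext => y; rewrite mulN1r.
by apply: smooth_nearM => //; exact: smooth_near_cst.
Qed.

End Calculus.

(** * Atlases and tangent vectors *)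

Section Atlas.
Context {R : realType} {M : Type} {n : nat}.
Implicit Types (A : set (chart R M n)) (k l : chart R M n).

(** The total spaces carry no topology, so that openness of chart domains and
    continuity of charts are expressed through the values of the charts. *)
Definition compatible_atlas A : Prop := forall k p, A k -> cdom k p ->
  [/\ cfrom k (cto k p) = p,
      \forall x \near cto k p, cto k (cfrom k x) = x &
      forall l, A l -> cdom l p ->
        (\forall x \near cto k p, cdom l (cfrom k x)) /\
        smooth_near (cto k p) (cto l \o cfrom k)].

Definition tvec A k (p : M) (w : 'rV[R]_n) : vop R M :=
  \sum_(j < n) w 0 j *: cvec A k j p.

Variable A : set (chart R M n).
Hypothesis Acomp : compatible_atlas A.

Section AtPoint.
Variables (k : chart R M n) (p : M).
Hypotheses (Ak : A k) (kp : cdom k p).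

Lemma cfromK : cfrom k (cto k p) = p.
Proof. by have [] := Acomp Ak kp. Qed.

Lemma near_ctoK : \forall x \near cto k p, cto k (cfrom k x) = x.
Proof. by have [] := Acomp Ak kp. Qed.

Lemma near_cdom l : A l -> cdom l p ->
  \forall x \near cto k p, cdom l (cfrom k x).
Proof. by move=> Al lp; have [_ _ /(_ l Al lp)[]] := Acomp Ak kp. Qed.

Lemma smooth_transition l : A l -> cdom l p ->
  smooth_near (cto k p) (cto l \o cfrom k).
Proof. by move=> Al lp; have [_ _ /(_ l Al lp)[]] := Acomp Ak kp. Qed.

(** Transition maps are continuous, so they carry a neighbourhood read in the
    chart k to a neighbourhood read in any other chart. *)
Lemma near_ptP S : near_pt A p S <-> \forall x \near cto k p, S (cfrom k x).
Proof.
split=> [/(_ k Ak kp)//|Sk l Al lp].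
have [lK _ /(_ k Ak kp)[kl /smooth_near_continuous ct]] := Acomp Al lp.
have := ct; rewrite /prop_for /continuous_at /= lK => /(_ _ Sk) /= {}Sk.
have [_ _ /(_ l Al lp)[lk _]] := Acomp Al lp.
have : \forall x \near cto l p, cfrom k (cto k (cfrom l x)) = cfrom l x.
  by apply: filterS kl => x kx; have [] := Acomp Ak kx.
move=> kK; near=> x.
have <- : cfrom k (cto k (cfrom l x)) = cfrom l x by near: x.
by near: x; exact: Sk.
Unshelve. all: by end_near. Qed.

Lemma near_pt_self S : near_pt A p S -> S p.
Proof. by move=> /near_ptP/nbhs_singleton; rewrite cfromK. Qed.

Lemma near_pt_cdom : near_pt A p (cdom k).
Proof. by apply/near_ptP; exact: near_cdom. Qed.

Lemma near_ptS (S S' : set M) : S `<=` S' -> near_pt A p S -> near_pt A p S'.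
Proof. by move=> SS /near_ptP nS; apply/near_ptP; apply: filterS nS => x /SS. Qed.

Lemma near_ptI (S S' : set M) :
  near_pt A p S -> near_pt A p S' -> near_pt A p (S `&` S').
Proof.
by move=> /near_ptP nS /near_ptP nS'; apply/near_ptP; apply: filterI.
Qed.

Lemma smooth_atP f : smooth_at A p f <-> smooth_near (cto k p) (f \o cfrom k).
Proof.
split=> [/(_ k Ak kp)//|Sf l Al lp].
have [lK _ /(_ k Ak kp)[kl St]] := Acomp Al lp.
apply: (@smooth_near_eq _ _ _ _ ((f \o cfrom k) \o (cto k \o cfrom l))).
  by apply: filterS kl => x kx /=; have [-> _ _] := Acomp Ak kx.
by apply: smooth_near_comp_scalar => //=; rewrite lK.
Qed.

Lemma smooth_at_near f :
  smooth_at A p f -> near_pt A p [set p' | smooth_at A p' f].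
Proof.
move=> /smooth_atP /smooth_near_near Sf; apply/near_ptP.
have nkK := near_ctoK; have nk := near_cdom Ak kp.
near=> x => l Al lp.
have kx : cdom k (cfrom k x) by near: x.
have xk : cto k (cfrom k x) = x by near: x.
have [lK _ /(_ k Ak kx)[kl St]] := Acomp Al lp.
apply: (@smooth_near_eq _ _ _ _ ((f \o cfrom k) \o (cto k \o cfrom l))).
  by apply: filterS kl => y ky /=; have [-> _ _] := Acomp Ak ky.
apply: smooth_near_comp_scalar => //=; rewrite lK xk.
by near: x.
Unshelve. all: by end_near. Qed.

Lemma smooth_at_eq f g : near_pt A p [set p' | f p' = g p'] ->
  smooth_at A p f -> smooth_at A p g.
Proof.
move=> fg Sf l Al lp; apply: smooth_near_eq (Sf l Al lp).
exact: (fg l Al lp).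
Qed.

Lemma smooth_at_cst (a : R) : smooth_at A p (cst a).
Proof. by move=> l _ _; exact: smooth_near_cst. Qed.

Lemma smooth_atD f g : smooth_at A p f -> smooth_at A p g ->
  smooth_at A p (fun p' => f p' + g p').
Proof.
by move=> Sf Sg l Al lp; apply: smooth_nearD; [exact: Sf|exact: Sg].
Qed.

Lemma smooth_atM f g : smooth_at A p f -> smooth_at A p g ->
  smooth_at A p (fun p' => f p' * g p').
Proof.
by move=> Sf Sg l Al lp; apply: smooth_nearM; [exact: Sf|exact: Sg].
Qed.

Lemma smooth_atN f : smooth_at A p f -> smooth_at A p (fun p' => - f p').
Proof. by move=> Sf l Al lp; apply: smooth_nearN; exact: Sf. Qed.

Lemma smooth_atB f g : smooth_at A p f -> smooth_at A p g ->
  smooth_at A p (fun p' => f p' - g p').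
Proof. by move=> Sf Sg; apply: smooth_atD => //; exact: smooth_atN. Qed.

Lemma smooth_at_sum (I : Type) (s : seq I) (P : pred I) (f : I -> M -> R) :
  (forall i, P i -> smooth_at A p (f i)) ->
  smooth_at A p (fun p' => \sum_(i <- s | P i) f i p').
Proof.
by move=> Sf l Al lp; apply: smooth_near_sum => i Pi; exact: Sf.
Qed.

Lemma smooth_at_coordf l j : A l -> cdom l p -> smooth_at A p (coordf l j).
Proof.
move=> Al lp; apply/smooth_atP.
by have /smooth_near_rowP/(_ j) := smooth_transition Al lp.
Qed.

Lemma smooth_at_partial f j :
  smooth_at A p f -> smooth_at A p (partial k j f).
Proof.
move=> /smooth_atP Sf; apply/smooth_atP.
have := smooth_near_derive (delta_mx 0 j) Sf; apply: smooth_near_eq.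
by apply: filterS near_ctoK => x xk /=; rewrite /partial xk.
Qed.

Lemma smooth_at_diff f : smooth_at A p f ->
  differentiable (f \o cfrom k) (cto k p).
Proof. by move=> /smooth_atP/smooth_near_differentiable. Qed.

Lemma partialE f j : smooth_at A p f ->
  partial k j f p = 'd (f \o cfrom k) (cto k p) (delta_mx 0 j).
Proof. by move=> Sf; rewrite /partial deriveE //; exact: smooth_at_diff. Qed.

Lemma sum_partialE f (w : 'rV[R]_n) : smooth_at A p f ->
  \sum_j w 0 j * partial k j f p = 'd (f \o cfrom k) (cto k p) w.
Proof.
move=> Sf; rewrite diff_row_sum; apply: eq_bigr => j _.
by rewrite partialE.
Qed.

Lemma tvecE f w : smooth_at A p f ->
  tvec A k p w f = 'd (f \o cfrom k) (cto k p) w.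
Proof.
move=> Sf; rewrite -sum_partialE // /tvec fct_sumE; apply: eq_bigr => j _.
have -> : (w 0 j *: cvec A k j p) f = w 0 j * cvec A k j p f by [].
by rewrite /cvec; case: asboolP.
Qed.

Lemma tvec_nsmooth f w : ~ smooth_at A p f -> tvec A k p w f = 0.
Proof.
move=> Sf; rewrite /tvec fct_sumE big1 // => j _.
have -> : (w 0 j *: cvec A k j p) f = w 0 j * cvec A k j p f by [].
by rewrite /cvec; case: asboolP => // _; rewrite mulr0.
Qed.

(** In the chart k, the function [coordf k j] is the j-th coordinate. *)
Lemma tvec_coordf w j : tvec A k p w (coordf k j) = w 0 j.
Proof.
rewrite tvecE; last exact: smooth_at_coordf.
rewrite (@near_eq_diff _ _ _ (fun x : 'rV[R]_n => x 0 j)).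
- rewrite -deriveE; last exact: differentiable_coord.
  by rewrite (@derive_coord _ _ _ id) // derive_id.
- by apply: filterS near_ctoK => x /= xk; rewrite /coordf /= xk.
- exact: differentiable_coord.
Qed.

Lemma tangent_tvecW w : tangent A p (tvec A k p w).
Proof. by exists k, w. Qed.

End AtPoint.

(** A tangent vector is given by components in some chart l; the chain rule for
    the transition from l to k turns them into components in k, which are
    recovered by letting the vector act on the coordinates of k. *)
Lemma tangent_tvec k p v : A k -> cdom k p -> tangent A p v ->
  v = tvec A k p (\row_j v (coordf k j)).
Proof.
move=> Ak kp [l [w [Al lp ->]]]; rewrite -/(tvec A l p w).
apply/funext => f; have [Sf|Sf] := pselect (smooth_at A p f); last first.
  by rewrite !tvec_nsmooth.
rewrite !tvecE //.
have St := smooth_transition Al lp Ak kp.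
have dt := smooth_near_differentiable St.
have -> : \row_j tvec A l p w (coordf k j) = 'd (cto k \o cfrom l) (cto l p) w.
  apply/rowP => j; rewrite mxE tvecE //; last exact: (smooth_at_coordf Ak kp).
  rewrite -(deriveE _ dt) -derive_coord // deriveE //.
  by have /differentiable_coordP := dt; apply.
have df := smooth_at_diff Ak kp Sf.
have lK : (cto k \o cfrom l) (cto l p) = cto k p by rewrite /= (cfromK Al lp).
have dfk : differentiable (f \o cfrom k) ((cto k \o cfrom l) (cto l p)).
  by rewrite lK.
have near_f : \forall x \near cto l p,
    ((f \o cfrom k) \o (cto k \o cfrom l)) x = (f \o cfrom l) x.
  by apply: filterS (near_cdom Al lp Ak kp) => x kx /=; rewrite (cfromK Ak kx).
apply: etrans (near_eq_diffE _ near_f (differentiable_comp dt dfk)) _.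
by apply: etrans (diff_compE _ dt dfk) _; rewrite lK.
Qed.

Section Tangent.
Variables (k : chart R M n) (p : M) (v : vop R M).
Hypotheses (Ak : A k) (kp : cdom k p) (vp : tangent A p v).

Lemma tangentE f : smooth_at A p f ->
  v f = 'd (f \o cfrom k) (cto k p) (\row_j v (coordf k j)).
Proof. by move=> Sf; rewrite {1}(tangent_tvec Ak kp vp) tvecE. Qed.

Lemma tangent_nsmooth f : ~ smooth_at A p f -> v f = 0.
Proof. by move=> Sf; rewrite (tangent_tvec Ak kp vp) tvec_nsmooth. Qed.

Lemma tangent_eq f g : near_pt A p [set p' | f p' = g p'] ->
  smooth_at A p f -> v f = v g.
Proof.
move=> fg Sf; have Sg := smooth_at_eq fg Sf.
rewrite (tangentE Sf) (tangentE Sg); apply/esym.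
exact: near_eq_diffE (fg k Ak kp) (smooth_at_diff Ak kp Sf).
Qed.

Lemma tangent_cst a : v (cst a) = 0.
Proof. by rewrite tangentE ?diff_cst //; exact: smooth_at_cst. Qed.

Lemma tangentD f g : smooth_at A p f -> smooth_at A p g ->
  v (fun p' => f p' + g p') = v f + v g.
Proof.
move=> Sf Sg; rewrite (tangentE (smooth_atD Sf Sg)) (tangentE Sf) (tangentE Sg).
have df := smooth_at_diff Ak kp Sf; have dg := smooth_at_diff Ak kp Sg.
by have /(congr1 (@^~ (\row_j v (coordf k j)))) := diffD df dg.
Qed.

Lemma tangentM f g : smooth_at A p f -> smooth_at A p g ->
  v (fun p' => f p' * g p') = f p * v g + g p * v f.
Proof.
move=> Sf Sg; rewrite (tangentE (smooth_atM Sf Sg)) (tangentE Sf) (tangentE Sg).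
have df := smooth_at_diff Ak kp Sf; have dg := smooth_at_diff Ak kp Sg.
have /(congr1 (@^~ (\row_j v (coordf k j)))) := diffM df dg.
by rewrite /= (cfromK Ak kp).
Qed.

Lemma tangentN f : smooth_at A p f -> v (fun p' => - f p') = - v f.
Proof.
move=> Sf; rewrite (tangentE (smooth_atN Sf)) (tangentE Sf).
have df := smooth_at_diff Ak kp Sf.
by have /(congr1 (@^~ (\row_j v (coordf k j)))) := diffN df.
Qed.

Lemma tangent_sum (I : Type) (s : seq I) (P : pred I) (f : I -> M -> R) :
  (forall i, P i -> smooth_at A p (f i)) ->
  v (fun p' => \sum_(i <- s | P i) f i p') = \sum_(i <- s | P i) v (f i).
Proof.
move=> Sf; elim: s => [|i s IH].
  by under eq_fun do rewrite big_nil; rewrite big_nil tangent_cst.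
under eq_fun do rewrite big_cons; rewrite big_cons.
case: ifPn => // Pi; rewrite tangentD ?IH //; first exact: Sf.
exact: smooth_at_sum.
Qed.

End Tangent.
End Atlas.

Lemma smooth_at_comp (R : realType) (M N : Type) (m n : nat)
    (A : set (chart R M m)) (B : set (chart R N n)) (F : M -> N)
    (k : chart R M m) (l : chart R N n) (p : M) (g : N -> R) :
  compatible_atlas A -> compatible_atlas B ->
  A k -> cdom k p -> B l -> cdom l (F p) ->
  smooth_map A B F -> smooth_at B (F p) g -> smooth_at A p (g \o F).
Proof.
move=> Ac Bc Ak kp Bl lp SF Sg; apply/(smooth_atP Ac Ak kp).
have [nl SFkl] := SF p k l Ak Bl kp lp.
apply: (@smooth_near_eq _ _ _ _ ((g \o cfrom l) \o (cto l \o F \o cfrom k))).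
  move/(near_ptP Ac Ak kp) : nl; apply: filterS => x lx /=.
  by rewrite (cfromK Bc Bl lx).
apply: smooth_near_comp_scalar => //=; rewrite (cfromK Ac Ak kp).
exact: Sg.
Qed.

(** The chain rule for g o F, with F read in charts of both manifolds. *)
Lemma diff_map (R : realType) (M N : Type) (m n : nat)
    (A : set (chart R M m)) (B : set (chart R N n)) (F : M -> N)
    (k : chart R M m) (l : chart R N n) (p : M) (g : N -> R) w :
  compatible_atlas A -> compatible_atlas B ->
  A k -> cdom k p -> B l -> cdom l (F p) ->
  smooth_map A B F -> smooth_at B (F p) g ->
  'd ((g \o F) \o cfrom k) (cto k p) w =
  'd (g \o cfrom l) (cto l (F p)) ('d (cto l \o F \o cfrom k) (cto k p) w).
Proof.
move=> Ac Bc Ak kp Bl lp SF Sg.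
have [nl /smooth_near_differentiable SFkl] := SF p k l Ak Bl kp lp.
have dg := smooth_at_diff Bc Bl lp Sg.
have kK := cfromK Ac Ak kp.
have FK : (cto l \o F \o cfrom k) (cto k p) = cto l (F p) by rewrite /= kK.
have dgF : differentiable (g \o cfrom l) ((cto l \o F \o cfrom k) (cto k p)).
  by rewrite FK.
have near_g : \forall x \near cto k p,
    ((g \o cfrom l) \o (cto l \o F \o cfrom k)) x = ((g \o F) \o cfrom k) x.
  move/(near_ptP Ac Ak kp) : nl; apply: filterS => x lx /=.
  by rewrite (cfromK Bc Bl lx).
apply: etrans (near_eq_diffE _ near_g (differentiable_comp SFkl dgF)) _.
by apply: etrans (diff_compE _ SFkl dgF) _; rewrite FK.
Qed.

(** * The atlas of the total space of a bundle *)

Section ManifoldAtlas.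
Context {R : realType} {n : nat} (Q : manifold R n).

(** The transition maps of a manifold are smooth on the image of the overlap of
    the domains; that this image is a neighbourhood comes from continuity of
    the inverse charts. *)
Lemma matlas_compatible : compatible_atlas (matlas Q).
Proof.
move=> k q Ak kq; have [ok oik kK ck ckf] := m_chart Ak.
have imk : (cto k @` cdom k) (cto k q) by exists q.
have nim : \forall x \near cto k q, (cto k @` cdom k) x.
  exact: open_nbhs_nbhs.
have ncdom l : matlas Q l -> cdom l q ->
    \forall x \near cto k q, cdom l (cfrom k x).
  move=> Al lq; have [ol _ _ _ _] := m_chart Al.
  apply: (ckf _ imk); rewrite kK //.
  exact: open_nbhs_nbhs.
split=> [||l Al lq]; first exact: kK.
  by apply: filterS nim => x [q' kq' <-]; rewrite kK.
split; first exact: ncdom.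
have [tr _] := m_compat Ak Al.
apply: smooth_near_nbhs tr.
near=> x.
have [q' kq' xq'] : (cto k @` cdom k) x by near: x.
exists q' => //; split=> //.
rewrite -(kK _ kq') xq'; near: x; exact: ncdom.
Unshelve. all: by end_near. Qed.

Lemma near_pt_open (U : set Q) q : open U -> U q -> near_pt (matlas Q) q U.
Proof.
move=> oU Uq k Ak kq; have [_ _ kK _ ckf] := m_chart Ak.
have imk : (cto k @` cdom k) (cto k q) by exists q.
by apply: (ckf _ imk); rewrite kK //; exact: open_nbhs_nbhs.
Qed.

End ManifoldAtlas.

Section Frame.
Context {R : realType} {n : nat} {Q : manifold R n} {F : Q -> vectType R}.
Context {r : nat}.
Variables (f : frame F r) (q : Q).
Hypothesis fq : basis_of fullv (fbas f q).

Lemma fcoord_sum (y : 'I_r -> R) a :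
  fcoord f a (\sum_b y b *: tnth (fbas f q) b) = y a.
Proof.
under eq_bigr do rewrite (tnth_nth 0).
by rewrite /fcoord coord_sum_free //; exact: basis_free fq.
Qed.

Lemma frame_expand (x : F q) : x = \sum_a fcoord f a x *: tnth (fbas f q) a.
Proof.
under eq_bigr do rewrite (tnth_nth 0).
by rewrite /fcoord; apply: coord_basis fq _; exact: memvf.
Qed.

Lemma fcoord_basis a b : fcoord f a (tnth (fbas f q) b) = (a == b)%:R.
Proof.
rewrite (tnth_nth 0) /fcoord coord_free ?(eq_sym a) //.
exact: basis_free fq.
Qed.

Lemma fcoordP (x y : F q) : (forall a, fcoord f a x = fcoord f a y) -> x = y.
Proof.
move=> xy; rewrite (frame_expand x) (frame_expand y).
by apply: eq_bigr => a _; rewrite xy.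
Qed.

End Frame.

Section DualFrame.
Context {R : realType} {n : nat} {Q : manifold R n} {F : Q -> vectType R}.
Context {r : nat}.
Variables (f : frame F r) (q : Q).
Hypothesis fq : basis_of fullv (fbas f q).

Lemma dual_frame_tnth a (x : F q) :
  (tnth (fbas (dual_frame f) q) a : 'Hom(F q, R^o)) x = fcoord f a x.
Proof.
rewrite /= tnth_mktuple.
have lin : linear (fun x : F q => fcoord f a x : R^o).
  by move=> k u v; rewrite /fcoord linearP.
pose lM := GRing.isLinear.Build _ _ _ _ _ lin.
pose l : {linear F q -> R^o} := HB.pack (fun x : F q => fcoord f a x : R^o) lM.
exact: (lfunE l).
Qed.

(** Both sides agree on every x, by expanding x in the frame f. *)
Lemma dual_expand (phi : dual F q) :
  phi = \sum_a phi (tnth (fbas f q) a) *: tnth (fbas (dual_frame f) q) a.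
Proof.
apply/lfunP => x; rewrite sum_lfunE {1}(frame_expand fq x) linear_sum.
apply: eq_bigr => a _; rewrite scale_lfunE dual_frame_tnth linearZ /=.
exact: mulrC.
Qed.

Lemma dual_frame_basis : basis_of fullv (fbas (dual_frame f) q).
Proof.
apply/andP; split.
  rewrite eqEsubv subvf /=; apply/subvP => phi _; rewrite [phi]dual_expand.
  by apply: memv_suml => a _; rewrite memvZ // memv_span // mem_tnth.
apply/freeP => y y0 a.
  have := congr1 (fun phi : 'Hom(F q, R^o) => phi (tnth (fbas f q) a)) y0.
  rewrite sum_lfunE lfunE /= => <-.
  have dualE (b : 'I_r) :
      (fbas (dual_frame f) q)`_b = tnth (fbas (dual_frame f) q) b.
    by rewrite (tnth_nth 0).
  rewrite (bigD1 a) //= big1 ?addr0 => [|b ba].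
    by rewrite scale_lfunE dualE dual_frame_tnth (fcoord_basis fq) eqxx [RHS]mulr1.
  rewrite scale_lfunE dualE dual_frame_tnth (fcoord_basis fq) (negbTE ba).
  exact: mulr0.
Qed.

Lemma fcoord_dual a (phi : dual F q) :
  fcoord (dual_frame f) a phi = phi (tnth (fbas f q) a).
Proof.
by rewrite {1}[phi]dual_expand (fcoord_sum dual_frame_basis).
Qed.

End DualFrame.

Section TotalAtlas.
Context {R : realType} {n : nat} {Q : manifold R n} {r : nat}.
Context {E : lie_algebroid Q r} {F : Q -> vectType R}.

(** What E itself and its dual have in common: a rule turning smooth frames of E
    into frames of F whose transition coefficients are smooth. *)
Definition compatible_frames (g : frame E r -> frame F r) : Prop :=
  [/\ forall f, fdom (g f) = fdom f,
      forall f q, vframes f -> fdom f q -> basis_of fullv (fbas (g f) q) &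
      forall f f' q, vframes f -> vframes f' -> fdom f q -> fdom f' q ->
        forall a b, smooth_at (matlas Q) q
          (fun q' => fcoord (g f') b (tnth (fbas (g f) q') a))].

Variable g : frame E r -> frame F r.
Hypothesis gcomp : compatible_frames g.

(** The base coordinates of a point of the model space of a total space. *)
Definition qpart (x : 'rV[R]_(n + r + 1)) : 'rV[R]_n := lsubmx (lsubmx x).

Lemma qpartE x i : qpart x 0 i = x 0 (qI i).
Proof. by rewrite /qpart !mxE. Qed.

Lemma tot_ind (P : 'I_(n + r + 1) -> Prop) :
  (forall i, P (qI i)) -> (forall a, P (yI a)) -> P sI -> forall j, P j.
Proof.
move=> Pq Py Ps j; case: (split_ordP j) => [j' ->|o ->].
  by case: (split_ordP j') => i ->; [exact: Pq|exact: Py].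
by rewrite (ord1 o); exact: Ps.
Qed.

Lemma tot_sum (V : nmodType) (G : 'I_(n + r + 1) -> V) :
  \sum_j G j = \sum_i G (qI i) + \sum_a G (yI a) + G sI.
Proof. by rewrite !big_split_ord big_ord1. Qed.

Section Coordinates.
Variables (c : chart R Q n) (f : frame F r) (p : totR F).

Lemma cto_qI i : cto (tot_chart c f) p 0 (qI i) = cto c (bproj p) 0 i.
Proof. by rewrite /= !row_mxEl. Qed.

Lemma cto_yI a : cto (tot_chart c f) p 0 (yI a) = fcoord f a (fibre p).
Proof. by rewrite /= row_mxEl row_mxEr mxE. Qed.

Lemma cto_sI : cto (tot_chart c f) p 0 sI = p.2.
Proof. by rewrite /= row_mxEr mxE. Qed.

Lemma qpart_cto : qpart (cto (tot_chart c f) p) = cto c (bproj p).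
Proof. by rewrite /qpart /= !row_mxKl. Qed.

End Coordinates.

Lemma tot_chart_cfrom (c : chart R Q n) (f : frame F r) x :
  cfrom (tot_chart c f) x =
  mkpt (\sum_a x 0 (yI a) *: tnth (fbas f (cfrom c (qpart x))) a) (x 0 sI).
Proof.
rewrite /=; congr (mkpt _ _); last by rewrite mxE.
by apply: eq_bigr => a _; rewrite !mxE.
Qed.

Lemma smooth_near_qpart x : smooth_near x qpart.
Proof.
apply/smooth_near_rowP => i; under eq_fun do rewrite qpartE.
by have /smooth_near_rowP := smooth_near_id x; apply.
Qed.

Lemma smooth_near_coord x j :
  smooth_near x (fun y : 'rV[R]_(n + r + 1) => y 0 j).
Proof. by have /smooth_near_rowP := smooth_near_id x; apply. Qed.

(** The base point reconstructed from the coordinates is only propositionally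
    equal to the original one; both sides are written with the same
    coefficients, so that the base points can be identified. *)
Lemma tot_chart_cfromK c f p : matlas Q c -> vframes f -> cdom c (bproj p) ->
  fdom f (bproj p) ->
  cfrom (tot_chart c (g f)) (cto (tot_chart c (g f)) p) = p.
Proof.
move=> Ac Vf cp fp; rewrite tot_chart_cfrom qpart_cto cto_sI.
under eq_bigr do rewrite cto_yI.
case: p cp fp => -[q x] s /= cp fp.
have [_ gb _] := gcomp.
rewrite /mkpt /= /bproj /fibre /=; congr (_, _).
rewrite [in RHS](frame_expand (gb f q Vf fp) x).
by move: (cfrom c _) (cfromK (@matlas_compatible _ _ Q) Ac cp) => q' ->.
Qed.

(** A transition map is a transition map of the base in q, is linear in y with
    the smooth coefficients of the change of frame, and is the identity in s. *)
Lemma tot_atlas_compatible : compatible_atlas (tot_atlas g).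
Proof.
have [gd gb gc] := gcomp; have Qc := @matlas_compatible _ _ Q.
move=> k0 p [c [f [Ac Vf ->{k0}]]] kp; set k := tot_chart c (g f).
have cp : cdom c (bproj p) by case: kp.
have fp : fdom f (bproj p) by rewrite -gd; case: kp.
have cq : {for cto k p, continuous qpart}.
  exact/smooth_near_continuous/smooth_near_qpart.
have near_q (P : 'rV[R]_n -> Prop) : (\forall z \near cto c (bproj p), P z) ->
    \forall x \near cto k p, P (qpart x).
  by move=> nP; apply: cq; rewrite qpart_cto.
have nf : \forall x \near cto k p, fdom f (cfrom c (qpart x)).
  apply: (near_q (fun z => fdom f (cfrom c z))).
  have [of_ _] := vb_frame Vf.
  exact: (near_pt_open of_ fp).
split; first exact: tot_chart_cfromK.
  have ncK : \forall x \near cto k p, cto c (cfrom c (qpart x)) = qpart x.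
    apply: (near_q (fun z => cto c (cfrom c z) = z)); exact: (near_ctoK Qc Ac cp).
  apply: filterS2 ncK nf => x xK fx; apply/rowP => j.
  rewrite [cfrom k x]tot_chart_cfrom; elim/tot_ind: j => [i|a|].
  - by rewrite [LHS]cto_qI /bproj /= xK qpartE.
  - by rewrite [LHS]cto_yI /fibre /= fcoord_sum //; exact: gb.
  - by rewrite [LHS]cto_sI.
move=> l [c' [f' [Ac' Vf' ->{l}]]] lp.
have c'p : cdom c' (bproj p) by case: lp.
have f'p : fdom f' (bproj p) by rewrite -gd; case: lp.
split.
  have nc' : \forall x \near cto k p, cdom c' (cfrom c (qpart x)).
    by apply: (near_q (fun z => cdom c' (cfrom c z)));
      exact: (near_cdom Qc Ac cp Ac' c'p).
  have nf' : \forall x \near cto k p, fdom f' (cfrom c (qpart x)).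
    apply: (near_q (fun z => fdom f' (cfrom c z))).
    have [of_ _] := vb_frame Vf'.
    exact: (near_pt_open of_ f'p).
  by apply: filterS2 nc' nf' => x c'x f'x; split; rewrite ?gd.
apply/smooth_near_rowP; elim/tot_ind => [i|b|].
- rewrite (_ : (fun x => _) = (coordf c' i \o cfrom c) \o qpart).
    apply: smooth_near_comp_scalar; first exact: smooth_near_qpart.
    rewrite qpart_cto; exact: (smooth_at_coordf Qc Ac cp i Ac' c'p).
  by apply/funext => x; rewrite [LHS]cto_qI.
- pose G (x : 'rV[R]_(n + r + 1)) : R := \sum_a x 0 (yI a) *
     ((fun q' => fcoord (g f') b (tnth (fbas (g f) q') a)) \o cfrom c \o qpart) x.
  rewrite (_ : (fun x => _) = G); last first.
    apply/funext => x; rewrite /G /comp [cfrom k x]tot_chart_cfrom [LHS]cto_yI.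
    rewrite /fibre /= /fcoord linear_sum.
    by apply: eq_bigr => a _; rewrite linearZ.
  apply: smooth_near_sum => a _; apply: smooth_nearM.
    exact: smooth_near_coord.
  apply: smooth_near_comp_scalar; first exact: smooth_near_qpart.
  rewrite qpart_cto; exact: (gc f f' _ Vf Vf' fp f'p a b c Ac cp).
- rewrite (_ : (fun x => _) = (fun x : 'rV[R]_(n + r + 1) => x 0 sI)).
    exact: smooth_near_coord.
  by apply/funext => x; rewrite [LHS]cto_sI [cfrom k x]tot_chart_cfrom.
Qed.

Lemma bproj_smooth : smooth_map (tot_atlas g) (matlas Q) bproj.
Proof.
have [gd gb gc] := gcomp; have Qc := @matlas_compatible _ _ Q.
move=> p k0 c' [c [f [Ac Vf ->{k0}]]] Ac' kp c'p; set k := tot_chart c (g f).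
have cp : cdom c (bproj p) by case: kp.
have fp : fdom f (bproj p) by rewrite -gd; case: kp.
have Ak : tot_atlas g k by exists c, f.
split.
  apply/(near_ptP tot_atlas_compatible Ak kp).
  have cq : {for cto k p, continuous qpart}.
    exact/smooth_near_continuous/smooth_near_qpart.
  have nc' := near_cdom Qc Ac cp Ac' c'p.
  by rewrite -(qpart_cto c (g f)) in nc'; exact: cq nc'.
rewrite (_ : _ \o cfrom k = (cto c' \o cfrom c) \o qpart) //.
apply: smooth_near_comp; first exact: smooth_near_qpart.
by rewrite qpart_cto; exact: (smooth_transition Qc Ac cp Ac' c'p).
Qed.

End TotalAtlas.

Section Instances.
Context {R : realType} {n : nat} {Q : manifold R n} {r : nat}.
Variable E : lie_algebroid Q r.

Lemma id_compatible : compatible_frames (E := E) (F := E) id.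
Proof.
split=> // [f q Vf|f f' q Vf Vf' fq f'q a b].
  by have [_] := vb_frame Vf; apply.
by have [_] := vb_compat Vf Vf' fq f'q a b.
Qed.

(** The change of dual frames is the transpose of the inverse change of
    frames. *)
Lemma dual_compatible :
  compatible_frames (E := E) (F := dual E) (@dual_frame _ _ _ _ E).
Proof.
have [_ idb idc] := id_compatible.
split=> // [f q Vf fq|f f' q Vf Vf' fq f'q a b].
  by apply: dual_frame_basis; exact: idb.
have [of_ _] := vb_frame Vf; have [of'_ _] := vb_frame Vf'.
apply: (smooth_at_eq _ (idc f' f q Vf' Vf f'q fq b a)).
move=> c Ac cq.
have nf := near_pt_open of_ fq Ac cq; have nf' := near_pt_open of'_ f'q Ac cq.
apply: filterS2 nf nf' => x fx f'x /=.
by rewrite fcoord_dual ?dual_frame_tnth //; exact: idb.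
Qed.

Lemma atlasE_compatible : compatible_atlas (atlasE (E := E)).
Proof. exact: tot_atlas_compatible id_compatible. Qed.

Lemma atlasEd_compatible : compatible_atlas (atlasEd (E := E)).
Proof. exact: tot_atlas_compatible dual_compatible. Qed.

End Instances.

(** * Sections of the prolongation *)

Section MapCoordinates.
Context {R : realType} {M N : Type} {m n : nat}.
Context {A : set (chart R M m)} {B : set (chart R N n)} {F : M -> N}.

Lemma diff_map_coord (k : chart R M m) (l : chart R N n) p w j :
  A k -> cdom k p -> B l -> cdom l (F p) -> smooth_map A B F ->
  ('d (cto l \o F \o cfrom k) (cto k p) w) 0 j =
  'd ((coordf l j \o F) \o cfrom k) (cto k p) w.
Proof.
move=> Ak kp Bl lp SF.
have [_ /smooth_near_differentiable d] := SF p k l Ak Bl kp lp.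
rewrite -(deriveE w d) -derive_coord // deriveE //.
by have /differentiable_coordP := d; apply.
Qed.

End MapCoordinates.

Section Prolongation.
Context {R : realType} {n : nat} {Q : manifold R n} {r : nat}.
Variable E : lie_algebroid Q r.
Context {F : Q -> vectType R}.
Variable g : frame E r -> frame F r.
Hypothesis gcomp : compatible_frames g.

Let A : set (chart R (totR F) (n + r + 1)) := tot_atlas g.
Let Ac : compatible_atlas A := tot_atlas_compatible gcomp.
Let Qc : compatible_atlas (matlas Q) := @matlas_compatible _ _ Q.

Lemma tot_chart_atlas c f (p : totR F) :
  adapted (E := E) c f p -> A (tot_chart c (g f)).
Proof. by move=> [? ? _ _]; exists c, f. Qed.

Lemma tot_chart_dom c f (p : totR F) :
  adapted (E := E) c f p -> cdom (tot_chart c (g f)) p.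
Proof. by have [gd _ _] := gcomp; move=> [_ _ cp fp]; split; rewrite ?gd. Qed.

Lemma near_adapted c f (p : totR F) : adapted (E := E) c f p ->
  near_pt A p [set p' | adapted (E := E) c f p'].
Proof.
move=> acf; have [gd _ _] := gcomp; have [Qcc Vf _ _] := acf.
apply: (near_ptS Ac (tot_chart_atlas acf) (tot_chart_dom acf)); last first.
  exact: (near_pt_cdom Ac (tot_chart_atlas acf) (tot_chart_dom acf)).
by move=> p' [cp' fp']; split; rewrite // -gd.
Qed.

Lemma exists_adapted (p : totR F) : exists c f, adapted (E := E) c f p.
Proof.
have [c Ac' cp] := m_cover (bproj p); have [f Vf fp] := vb_cover E (bproj p).
by exists c, f.
Qed.

Lemma tot_atlas_cover (p : totR F) : exists2 k, A k & cdom k p.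
Proof.
have [c [f acf]] := exists_adapted p.
exists (tot_chart c (g f)); first exact: (tot_chart_atlas acf).
exact: (tot_chart_dom acf).
Qed.

Lemma snd_coordf c f : (snd : totR F -> R) = coordf (tot_chart c (g f)) sI.
Proof. by apply/funext => p; rewrite /coordf cto_sI. Qed.

Section Coordinates.
Variables (c : chart R Q n) (f : frame E r) (p : totR F).
Hypothesis acf : adapted (E := E) c f p.
Let k := tot_chart c (g f).
Let Ak : A k := tot_chart_atlas acf.
Let kp : cdom k p := tot_chart_dom acf.

Lemma frame_basis : basis_of fullv (fbas f (bproj p)).
Proof. by have [_ Vf _ fp] := acf; have [_] := vb_frame Vf; apply. Qed.

Lemma cvec_coordf i j : cvec A k i p (coordf k j) = (j == i)%:R.
Proof.
have Sj := smooth_at_coordf Ac Ak kp j Ak kp.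
have -> : cvec A k i p (coordf k j) = tvec A k p (delta_mx 0 i) (coordf k j).
  rewrite (tvecE Ac Ak kp _ Sj) -(partialE Ac Ak kp i Sj).
  by rewrite /cvec; case: asboolP.
by rewrite (tvec_coordf Ac Ak kp) mxE eqxx.
Qed.

(** Linearity of the anchor on the expansion of x in the frame. *)
Lemma anchor_coordf (x : E (bproj p)) i :
  anchor x (coordf c i) = \sum_a rhof c f i a (bproj p) * fcoord f a x.
Proof.
rewrite {1}(frame_expand frame_basis x).
have ancD (q : Q) (y z : E q) : anchor (y + z) = anchor y + anchor z.
  by rewrite -[y in LHS]scale1r anchor_linear scale1r.
have anc0 (q : Q) : anchor (0 : E q) = 0.
  by have /esym/eqP := ancD q 0 0; rewrite addr0 -subr_eq0 addrK => /eqP.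
have ancZ (q : Q) t (y : E q) : anchor (t *: y) = t *: anchor y.
  by have := anchor_linear t y 0; rewrite anc0 !addr0.
rewrite (big_morph _ (ancD _) (anc0 _)) fct_sumE; apply: eq_bigr => a _.
by rewrite ancZ [RHS]mulrC.
Qed.

Lemma in_prol_qI (z : prolT E p) i : in_prol g z ->
  z.2 (coordf k (qI i)) = \sum_a rhof c f i a (bproj p) * fcoord f a z.1.
Proof.
move=> [_ /(congr1 (@^~ (coordf c i)))]; rewrite anchor_coordf => ->.
have [Acc _ cp _] := acf.
rewrite /tmap; case: asboolP => [_|[]]; last exact: (smooth_at_coordf Qc Acc cp).
by congr (z.2 _); apply/funext => p'; rewrite /coordf cto_qI.
Qed.

(** The projection to Q forgets the y and s components, so the condition
    rho(a) = T pi (v) concerns the q components of v only. *)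
Lemma in_prol_tvec (x : E (bproj p)) (w : 'rV[R]_(n + r + 1)) :
  (forall i, w 0 (qI i) = \sum_a rhof c f i a (bproj p) * fcoord f a x) ->
  in_prol g ((x, tvec A k p w) : prolT E p).
Proof.
move=> wx; have [Acc _ cp _] := acf.
split; first exact: tangent_tvecW.
have tx := anchor_tangent x; have bs := bproj_smooth gcomp.
apply/funext => h; rewrite /tmap; case: asboolP => [Sh|Sh]; last first.
  exact: (tangent_nsmooth Qc Acc cp tx Sh).
rewrite (tangentE Qc Acc cp tx Sh) /=.
rewrite (tvecE Ac Ak kp _ (smooth_at_comp Ac Qc Ak kp Acc cp bs Sh)).
rewrite (diff_map _ Ac Qc Ak kp Acc cp bs Sh); congr ('d _ _ _).
apply/rowP => i; rewrite mxE (diff_map_coord _ _ Ak kp Acc cp bs).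
rewrite anchor_coordf -wx -(tvec_coordf Ac Ak kp w (qI i)).
rewrite (tvecE Ac Ak kp _ (smooth_at_coordf Ac Ak kp _ Ak kp)).
congr ('d _ _ _); apply/funext => y /=.
by rewrite /coordf cto_qI.
Qed.

End Coordinates.

Section ConstantSections.
Variables (c : chart R Q n) (f : frame E r) (W u : 'I_r -> R) (us : R).

(** Components of a vector over q whose E-part has components W: those along q
    are dictated by the anchor, those along y and s are free. *)
Definition const_vec (q : Q) : 'rV[R]_(n + r + 1) :=
  row_mx (row_mx (\row_i \sum_a rhof c f i a q * W a) (\row_a u a))
         (\row_(_ < 1) us).

Lemma const_vec_qI q i : const_vec q 0 (qI i) = \sum_a rhof c f i a q * W a.
Proof. by rewrite /const_vec !row_mxEl mxE. Qed.

Lemma const_vec_yI q a : const_vec q 0 (yI a) = u a.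
Proof. by rewrite /const_vec row_mxEl row_mxEr mxE. Qed.

Lemma const_vec_sI q : const_vec q 0 sI = us.
Proof. by rewrite /const_vec row_mxEr mxE. Qed.

Definition const_sec (p : totR F) : prolT E p :=
  (\sum_a W a *: tnth (fbas f (bproj p)) a,
   tvec A (tot_chart c (g f)) p (const_vec (bproj p))).

Lemma const_sec_in_prol p : adapted (E := E) c f p -> in_prol g (const_sec p).
Proof.
move=> acf; apply: (in_prol_tvec acf) => i; rewrite const_vec_qI.
by apply: eq_bigr => a _; rewrite (fcoord_sum (frame_basis acf)).
Qed.

(** In another adapted frame the components are multiplied by the coefficients
    of the change of frame, and the vector part acts on the new coordinates by
    partial derivatives; all of these are smooth. *)
Lemma const_sec_section p :
  adapted (E := E) c f p -> prol_section_near g p const_sec.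
Proof.
move=> acf; have Ak := tot_chart_atlas acf; have kp := tot_chart_dom acf.
have [Acc Vf cp fp] := acf; have bs := bproj_smooth gcomp.
have pull := fun h => @smooth_at_comp _ _ _ _ _ _ _ _ _ c _ h Ac Qc Ak kp Acc cp bs.
split.
  by apply: (near_ptS Ac Ak kp _ (near_adapted acf)) => p'; exact: const_sec_in_prol.
move=> c' f' acf'; have [_ Vf' _ f'p] := acf'; split=> [b|j].
  pose G (p' : totR F) : R := \sum_a
    W a * ((fun q => fcoord f' b (tnth (fbas f q) a)) \o bproj) p'.
  have -> : Xcomp f' b const_sec = G.
    apply/funext => p'; rewrite /Xcomp /G /fcoord linear_sum.
    by apply: eq_bigr => a _; rewrite linearZ.
  apply: smooth_at_sum => a _; apply: smooth_atM; first exact: smooth_at_cst.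
  apply: pull.
  have [_ _ idc] := id_compatible E.
  exact: (idc f f' _ Vf Vf' fp f'p a b).
set k := tot_chart c (g f).
have Sj : smooth_at A p (coordf (tot_chart c' (g f')) j).
  have A' := tot_chart_atlas acf'.
  exact: (smooth_at_coordf Ac Ak kp _ A' (tot_chart_dom acf')).
pose G (p' : totR F) : R := \sum_i const_vec (bproj p') 0 i *
  partial k i (coordf (tot_chart c' (g f')) j) p'.
apply: (@smooth_at_eq _ _ _ A p G).
  apply: (near_ptS Ac Ak kp _ (near_ptI Ac Ak kp (smooth_at_near Ac Ak kp Sj)
    (near_adapted acf))) => p' [Sj' acf''].
  have kp' := tot_chart_dom acf''.
  rewrite /= /G /vcomp /const_sec /= (tvecE Ac Ak kp' _ Sj').
  by rewrite (sum_partialE Ac Ak kp').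
apply: smooth_at_sum => i _; apply: smooth_atM; last first.
  exact: (smooth_at_partial Ac Ak kp).
move: i; apply: (@tot_ind n r) => [i|a|].
- pose G' (p' : totR F) : R := \sum_a (rhof c f i a \o bproj) p' * W a.
  have -> : (fun p' : totR F => const_vec (bproj p') 0 (qI i)) = G'.
    by apply/funext => p'; rewrite const_vec_qI.
  apply: smooth_at_sum => a _; apply: smooth_atM; last exact: smooth_at_cst.
  by apply: pull; exact: anchor_smooth.
- rewrite (_ : (fun p' : totR F => _) = cst (u a)); first exact: smooth_at_cst.
  by apply/funext => p'; rewrite const_vec_yI.
- rewrite (_ : (fun p' : totR F => _) = cst us); first exact: smooth_at_cst.
  by apply/funext => p'; rewrite const_vec_sI.
Qed.

End ConstantSections.
End Prolongation.

(** * The differential of a contact form *)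

Section Differential.
Context {R : realType} {n : nat} {Q : manifold R n} {r : nat}.
Variable E : lie_algebroid Q r.
Context {F : Q -> vectType R}.
Variable g : frame E r -> frame F r.
Hypothesis gcomp : compatible_frames g.

Let A : set (chart R (totR F) (n + r + 1)) := tot_atlas g.
Let Ac : compatible_atlas A := tot_atlas_compatible gcomp.

Variables (c : chart R Q n) (f : frame E r) (p : totR F).
Hypothesis acf : adapted (E := E) c f p.
Let k := tot_chart c (g f).
Let Ak : A k := tot_chart_atlas g acf.
Let kp : cdom k p := tot_chart_dom gcomp acf.

Lemma prol_br_fst z w a : fcoord f a (prol_br g c f z w p).1 =
  (z p).2 (Xcomp f a w) - (w p).2 (Xcomp f a z)
  + \sum_(b < r) \sum_(d < r)
      Xcomp f b z p * Xcomp f d w p * strf f b d a (bproj p).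
Proof.
rewrite /prol_br /= !(big_morph fst (fun x y => erefl) erefl) /=.
rewrite (big1 _ _ (fun a => _ *: 0)) => [|b _]; last exact: scaler0.
by rewrite scaler0 !addr0 (fcoord_sum (frame_basis acf)).
Qed.

(** Only the basis section V_s has a component along d/ds. *)
Lemma prol_br_snd z w :
  (prol_br g c f z w p).2 snd =
  (z p).2 (vcomp g c f sI w) - (w p).2 (vcomp g c f sI z).
Proof.
rewrite (snd_coordf g c f) /prol_br /=.
rewrite !(big_morph snd (fun x y => erefl) erefl) /=.
pose ev (v : vop R (totR F)) : R := v (coordf (tot_chart c (g f)) sI).
have evD v1 v2 : ev (v1 + v2) = ev v1 + ev v2 by [].
have evZ t v : ev (t *: v) = t * ev v by [].
have ev0 : ev 0 = 0 by [].
rewrite -[LHS]/(ev (_ + _ + _)) (evD (_ + _)) evD !(big_morph ev evD ev0) evZ.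
have evX d : ev (Xsec g c f d p).2 = 0.
  rewrite /= (big_morph ev evD ev0) big1 // => i _.
  by rewrite evZ /ev (cvec_coordf gcomp acf) eq_rlshift mulr0.
rewrite [X in X + _ + _]big1 ?add0r => [|d _]; last by rewrite evZ evX mulr0.
rewrite [X in X + _]big1 ?add0r => [|a _].
  by rewrite /ev (cvec_coordf gcomp acf) eqxx mulr1.
by rewrite evZ /ev (cvec_coordf gcomp acf) eq_rlshift mulr0.
Qed.

Variables (theta : 'I_r -> totR F -> R) (eta : forall p : totR F, prolT E p -> R).
Hypothesis theta_smooth : forall a, smooth_at A p (theta a).
Hypothesis eta_theta : near_pt A p [set p' | forall z : prolT E p',
  eta z = z.2 snd - \sum_a theta a p' * fcoord f a z.1].

(** The Leibniz rule applied to eta(w) = w_s - theta_a W^a. *)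
Lemma tangent_theta_form v w : tangent A p v -> prol_section_near g p w ->
  v (fun p' => eta (w p')) = v (vcomp g c f sI w) -
    \sum_a (theta a p * v (Xcomp f a w) + Xcomp f a w p * v (theta a)).
Proof.
move=> tv [_ /(_ c f acf)[SX Sv]].
have St a : smooth_at A p (fun p' => theta a p' * Xcomp f a w p').
  by apply: smooth_atM.
have SS : smooth_at A p (fun p' => \sum_a theta a p' * Xcomp f a w p').
  by apply: smooth_at_sum.
have SN := smooth_atN SS.
rewrite -(tangent_eq Ac Ak kp tv (f := fun p' => vcomp g c f sI w p' +
   - \sum_a theta a p' * Xcomp f a w p')).
- rewrite (tangentD Ac Ak kp tv (Sv sI) SN) (tangentN Ac Ak kp tv SS).
  rewrite (tangent_sum Ac Ak kp tv) //; congr (_ - _).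
  by apply: eq_bigr => a _; rewrite (tangentM Ac Ak kp tv).
- apply: (near_ptS Ac Ak kp _ eta_theta) => p' /= ->.
  by rewrite /vcomp -(snd_coordf g c f).
- exact: smooth_atD.
Qed.

(** The derivatives of the components of z and w produced by the Leibniz rule
    cancel those in the bracket, leaving a tensorial expression. *)
Lemma dform_theta z w : prol_section_near g p z -> prol_section_near g p w ->
  dform g c f eta z w p =
  \sum_a ((w p).2 (theta a) * Xcomp f a z p - (z p).2 (theta a) * Xcomp f a w p)
  + \sum_d theta d p * \sum_a \sum_b
      Xcomp f a z p * Xcomp f b w p * strf f a b d (bproj p).
Proof.
move=> Sz Sw.
have [/(near_pt_self Ac Ak kp)/= [tz _] _] := Sz.
have [/(near_pt_self Ac Ak kp)/= [tw _] _] := Sw.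
rewrite /dform !tangent_theta_form // (near_pt_self Ac Ak kp eta_theta) prol_br_snd.
under [X in _ - (_ - X)]eq_bigr do rewrite prol_br_fst.
set zw := (z p).2 _; set wz := (w p).2 _.
transitivity (
  - \sum_a (theta a p * (z p).2 (Xcomp f a w)
            + Xcomp f a w p * (z p).2 (theta a))
  + \sum_a (theta a p * (w p).2 (Xcomp f a z)
            + Xcomp f a z p * (w p).2 (theta a))
  + \sum_a theta a p * ((z p).2 (Xcomp f a w) - (w p).2 (Xcomp f a z) +
     \sum_(b < r) \sum_(d < r)
       Xcomp f b z p * Xcomp f d w p * strf f b d a (bproj p))).
  by ring.
rewrite -sumrN -!big_split /=; apply: eq_bigr => a _; by ring.
Qed.

(** The defining equations of a Hamiltonian section at p, tested on the sections
    with constant components. The derivative of h along the Reeb section enters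
    as an unspecified number rho. *)
Lemma hamiltonian_section_eqs reeb h z :
  is_hamiltonian_section g eta reeb h z ->
  (z p).2 snd - \sum_a theta a p * Xcomp f a z p = - h p /\
  exists rho : R, forall (W u : 'I_r -> R) (us : R),
    let v := tvec A k p (const_vec c f W u us (bproj p)) in
    \sum_a (v (theta a) * Xcomp f a z p - (z p).2 (theta a) * W a)
    + \sum_d theta d p * \sum_a \sum_b
        Xcomp f a z p * W b * strf f a b d (bproj p)
    = v h - rho * (us - \sum_a theta a p * W a).
Proof.
move=> [[_ /(_ p) Sz] /(_ p)[etaz eqz]].
have etaE := near_pt_self Ac Ak kp eta_theta.
split; first by rewrite -etaz etaE.
exists ((reeb p).2 h) => W u us v.
have Sw := const_sec_section gcomp W u us acf.
have XW a : Xcomp f a (const_sec g c f W u us) p = W a.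
  by rewrite /Xcomp /= (fcoord_sum (frame_basis acf)).
have := eqz c f _ acf Sw; rewrite dform_theta // etaE => e.
have sE : (const_sec g c f W u us p).2 snd = us.
  by rewrite (snd_coordf g c f) /= (tvec_coordf Ac Ak kp) const_vec_sI.
move: e; rewrite sE.
under eq_bigr do rewrite XW.
under [X in _ + X = _ -> _]eq_bigr do
  under eq_bigr do under eq_bigr do rewrite XW.
under [X in _ = _ - _ * (_ - X) -> _]eq_bigr do
  rewrite -[fcoord _ _ _]/(Xcomp f _ _ _) XW.
by [].
Qed.

End Differential.

(** * The Legendre transformation in coordinates *)

Section FibreDerivative.
Context {R : realType} {n : nat} {Q : manifold R n} {r : nat}.
Variable E : lie_algebroid Q r.

Let A := atlasE (E := E).
Let Ac : compatible_atlas A := @atlasE_compatible _ _ _ _ E.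

Variables (c : chart R Q n) (f : frame E r) (p : totR E).
Hypothesis acf : adapted c f p.
Let k := tot_chart c f.
Let Ak : A k := tot_chart_atlas id acf.
Let kp : cdom k p := tot_chart_dom (id_compatible E) acf.

(** In coordinates, moving along the fibre is moving along a straight line in
    the y directions. *)
Lemma derive1_fibre (h : totR E -> R) (x : E (bproj p)) : smooth_at A p h ->
  derive1 (fun t : R => h (mkpt (fibre p + t *: x) p.2) : R^o) 0 =
  \sum_a fcoord f a x * partial k (yI a) h p.
Proof.
move=> Sh; have [Acc Vf cp fp] := acf.
pose v : 'rV[R]_(n + r + 1) :=
  row_mx (row_mx 0 (\row_a fcoord f a x)) 0.
have vq i : v 0 (qI i) = 0 by rewrite /v !row_mxEl mxE.
have vy a : v 0 (yI a) = fcoord f a x by rewrite /v row_mxEl row_mxEr mxE.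
have vs : v 0 sI = 0 by rewrite /v row_mxEr mxE.
have line t : mkpt (fibre p + t *: x) p.2 = cfrom k (t *: v + cto k p).
  rewrite -[LHS](tot_chart_cfromK (id_compatible E) Acc Vf); try by [].
  congr (cfrom _ _); apply/rowP; apply: (@tot_ind n r) => [i|a|].
  - by rewrite [LHS]cto_qI [RHS]mxE cto_qI mxE vq mulr0 add0r.
  - rewrite [LHS]cto_yI [RHS]mxE cto_yI mxE vy.
    by rewrite /fibre /= /fcoord linearD linearZ addrC.
  - by rewrite [LHS]cto_sI [RHS]mxE cto_sI mxE vs mulr0 add0r.
transitivity ('D_v (h \o cfrom k) (cto k p)).
  rewrite /derive1 /derive; set d := (fun _ : R => _); set d' := (fun _ : R => _).
  suff -> : d = d' by [].
  by apply/funext => t; rewrite /d /d' !line /= addr0 scale0r add0r.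
have dh := smooth_at_diff Ac Ak kp Sh.
rewrite (deriveE _ dh) -(sum_partialE Ac Ak kp v Sh) tot_sum vs mul0r addr0.
rewrite big1 ?add0r => [|i _]; last by rewrite vq mul0r.
by apply: eq_bigr => a _; rewrite vy.
Qed.

Variable L : totR E -> R.
Hypothesis hL : smooth_at A p L.

Lemma ThetaLE (z : prolT E p) :
  ThetaL L z = \sum_a partial k (yI a) L p * fcoord f a z.1.
Proof.
rewrite /ThetaL /SE /= /tot_vlift; case: asboolP => // _.
rewrite derive1_fibre //; by apply: eq_bigr => a _; rewrite mulrC.
Qed.

Lemma energyE :
  energy L p = \sum_a coordf k (yI a) p * partial k (yI a) L p - L p.
Proof.
rewrite /energy /DeltaE /= /tot_vlift; case: asboolP => // _.
rewrite derive1_fibre //; congr (_ - _); apply: eq_bigr => a _.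
by rewrite /coordf cto_yI.
Qed.

(** The map defining the fibre derivative is linear by [derive1_fibre], so that
    [linfun] represents it faithfully. *)
Lemma legendre_fibreE (b : E (bproj p)) : (legendre_fibre L p : 'Hom(_, R^o)) b =
  \sum_a fcoord f a b * partial k (yI a) L p.
Proof.
pose D (b : E (bproj p)) : R^o :=
  derive1 (fun t : R => L (mkpt (fibre p + t *: b) p.2) : R^o) 0.
have DE y : D y = \sum_a fcoord f a y * partial k (yI a) L p.
  exact: derive1_fibre.
have lin : linear D.
  move=> t y z; rewrite !DE scaler_sumr -big_split; apply: eq_bigr => a _ /=.
  by rewrite /fcoord linearP /= mulrDl -mulrA.
pose lM := GRing.isLinear.Build _ _ _ _ _ lin.
pose l : {linear E (bproj p) -> R^o} := HB.pack D lM.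
exact: etrans (lfunE l b) (DE b).
Qed.

Lemma legendre_yI a :
  coordf (tot_chart c (dual_frame f)) (yI a) (legendre L p) = partial k (yI a) L p.
Proof.
have fb := frame_basis acf.
rewrite /coordf cto_yI /fibre /= fcoord_dual // legendre_fibreE.
rewrite (bigD1 a) //= fcoord_basis // eqxx mul1r big1 ?addr0 // => b ba.
by rewrite fcoord_basis // (negbTE ba) mul0r.
Qed.

Lemma legendre_qI i :
  coordf (tot_chart c (dual_frame f)) (qI i) (legendre L p) = coordf k (qI i) p.
Proof. by rewrite /coordf !cto_qI. Qed.

Lemma legendre_sI :
  coordf (tot_chart c (dual_frame f)) sI (legendre L p) = coordf k sI p.
Proof. by rewrite /coordf !cto_sI. Qed.

End FibreDerivative.

Lemma Theta_canE (R : realType) (n : nat) (Q : manifold R n) (r : nat)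
    (E : lie_algebroid Q r) (c : chart R Q n) (f : frame E r)
    (p : totR (dual E)) (z : prolT E p) : adapted (E := E) c f p ->
  Theta_can z = \sum_a coordf (tot_chart c (dual_frame f)) (yI a) p * fcoord f a z.1.
Proof.
move=> acf; have fb := frame_basis acf.
rewrite /Theta_can {1}(frame_expand fb z.1) linear_sum; apply: eq_bigr => a _.
by rewrite linearZ /coordf cto_yI fcoord_dual // [RHS]mulrC.
Qed.

Section Legendre.
Context {R : realType} {n : nat} {Q : manifold R n} {r : nat}.
Variable E : lie_algebroid Q r.

Let A := atlasE (E := E).
Let B := atlasEd (E := E).
Let Ac : compatible_atlas A := @atlasE_compatible _ _ _ _ E.
Let Bc : compatible_atlas B := @atlasEd_compatible _ _ _ _ E.

Variables (L : totR E -> R) (Leginv : totR (dual E) -> totR E).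
Hypothesis hL : smooth_fun A L.
Hypothesis hLeg : hyperregular L Leginv.

Let LegK : cancel (legendre L) Leginv. Proof. by have [] := hLeg. Qed.
Let LeginvK : cancel Leginv (legendre L). Proof. by have [] := hLeg. Qed.
Let Leg_smooth : smooth_map A B (legendre L). Proof. by have [] := hLeg. Qed.
Let Leginv_smooth : smooth_map B A Leginv. Proof. by have [] := hLeg. Qed.

Let H : totR (dual E) -> R := energy L \o Leginv.

Lemma H_legendre : H \o legendre L = energy L.
Proof. by apply/funext => p; rewrite /H /= LegK. Qed.

Variables (c : chart R Q n) (f : frame E r) (p : totR E).
Hypothesis acf : adapted c f p.
Let k := tot_chart c f.
Let l := tot_chart c (dual_frame f).
Let Ak : A k := tot_chart_atlas id acf.
Let kp : cdom k p := tot_chart_dom (id_compatible E) acf.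
Let Bl : B l.
Proof. exact: (@tot_chart_atlas _ _ _ _ E _ _ c f (legendre L p) acf). Qed.
Let lp : cdom l (legendre L p).
Proof. exact: (tot_chart_dom (dual_compatible E) (p := legendre L p) acf). Qed.

Definition dlegendre (w : 'rV[R]_(n + r + 1)) : 'rV[R]_(n + r + 1) :=
  'd (cto l \o legendre L \o cfrom k) (cto k p) w.

Lemma diff_legendre h w : smooth_at B (legendre L p) h ->
  'd ((h \o legendre L) \o cfrom k) (cto k p) w =
  'd (h \o cfrom l) (cto l (legendre L p)) (dlegendre w).
Proof. exact: (diff_map w Ac Bc Ak kp Bl lp Leg_smooth). Qed.

Lemma smooth_legendre h :
  smooth_at B (legendre L p) h -> smooth_at A p (h \o legendre L).
Proof. exact: (smooth_at_comp Ac Bc Ak kp Bl lp Leg_smooth). Qed.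

Lemma tvec_legendre h w : smooth_at B (legendre L p) h ->
  tvec A k p w (h \o legendre L) = tvec B l (legendre L p) (dlegendre w) h.
Proof.
move=> Sh; rewrite (tvecE Bc Bl lp _ Sh) (tvecE Ac Ak kp _ (smooth_legendre Sh)).
exact: diff_legendre.
Qed.

Lemma dlegendre_coord j w :
  dlegendre w 0 j = tvec A k p w (coordf l j \o legendre L).
Proof.
have Sj := smooth_at_coordf Bc Bl lp j Bl lp.
by rewrite (tvec_legendre _ Sj) (tvec_coordf Bc Bl lp).
Qed.

Lemma dlegendre_qI i w : dlegendre w 0 (qI i) = w 0 (qI i).
Proof.
rewrite dlegendre_coord -(tvec_coordf Ac Ak kp w (qI i)); congr (tvec _ _ _ _ _).
by apply/funext => p'; exact: legendre_qI.
Qed.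

Lemma dlegendre_sI w : dlegendre w 0 sI = w 0 sI.
Proof.
rewrite dlegendre_coord -(tvec_coordf Ac Ak kp w sI); congr (tvec _ _ _ _ _).
by apply/funext => p'; exact: legendre_sI.
Qed.

Lemma near_legendre_yI a : near_pt A p
  [set p' | partial k (yI a) L p' = (coordf l (yI a) \o legendre L) p'].
Proof.
apply: (near_ptS Ac Ak kp _ (near_adapted (id_compatible E) acf)) => p' acf'.
by rewrite /= legendre_yI.
Qed.

Lemma smooth_partial_L j : smooth_at A p (partial k j L).
Proof. exact: (smooth_at_partial Ac Ak kp). Qed.

Lemma dlegendre_yI a w : dlegendre w 0 (yI a) = tvec A k p w (partial k (yI a) L).
Proof.
rewrite dlegendre_coord; apply/esym.
apply: (tangent_eq Ac Ak kp (tangent_tvecW Ak kp w) (near_legendre_yI a)).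
exact: smooth_partial_L.
Qed.

(** The differential of the inverse of Leg_L is a right inverse. *)
Lemma dlegendre_surj w' : exists w, dlegendre w = w'.
Proof.
pose p' := legendre L p; have p'K : Leginv p' = p := LegK p.
have kp' : cdom k (Leginv p') by rewrite p'K.
exists ('d (cto k \o Leginv \o cfrom l) (cto l p') w').
apply/rowP => j; rewrite dlegendre_coord.
have Sj := smooth_at_coordf Bc Bl lp j Bl lp.
have Sj' := smooth_legendre Sj.
have Sj'' : smooth_at A (Leginv p') (coordf l j \o legendre L) by rewrite p'K.
rewrite (tvecE Ac Ak kp _ Sj').
have := diff_map w' Bc Ac Bl lp Ak kp' Leginv_smooth Sj''.
rewrite -/p' p'K => <-.
rewrite -(tvec_coordf Bc Bl lp w' j) (tvecE Bc Bl lp _ Sj).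
have -> : (coordf l j \o legendre L) \o Leginv = coordf l j; last by [].
by apply/funext => y /=; rewrite LeginvK.
Qed.

(** The formula [energyE] holds near p with the same chart. *)
Lemma smooth_energy : smooth_at A p (energy L).
Proof.
pose G (p' : totR E) : R := \sum_a coordf k (yI a) p' * partial k (yI a) L p' - L p'.
apply: (@smooth_at_eq _ _ _ A p G).
  apply: (near_ptS Ac Ak kp _ (near_adapted (id_compatible E) acf)) => p' acf'.
  by rewrite /= (energyE acf').
apply: smooth_atB; last exact: hL.
apply: smooth_at_sum => a _; apply: smooth_atM; last exact: smooth_partial_L.
exact: (smooth_at_coordf Ac Ak kp _ Ak kp).
Qed.

Lemma smooth_H : smooth_at B (legendre L p) H.
Proof.
have kp' : cdom k (Leginv (legendre L p)) by rewrite LegK.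
apply: (smooth_at_comp Bc Ac Bl lp Ak kp' Leginv_smooth).
by rewrite LegK; exact: smooth_energy.
Qed.

(** In d(y^a dL/dy^a - L) the terms dL/dy^a dy^a cancel. *)
Lemma tvec_energy w : tvec A k p w (energy L) =
  \sum_a coordf k (yI a) p * tvec A k p w (partial k (yI a) L)
  - \sum_i partial k (qI i) L p * w 0 (qI i) - partial k sI L p * w 0 sI.
Proof.
have tw := tangent_tvecW Ak kp w; set v := tvec A k p w in tw *.
have Sy a := smooth_at_coordf Ac Ak kp (yI a) Ak kp.
have Sp a := smooth_partial_L (yI a).
have Sa a : smooth_at A p
    (fun p' => coordf k (yI a) p' * partial k (yI a) L p') by exact: smooth_atM.
have SS : smooth_at A p
    (fun p' => \sum_a coordf k (yI a) p' * partial k (yI a) L p').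
  by apply: smooth_at_sum.
have hLp : smooth_at A p L by exact: hL.
have SN := smooth_atN hLp.
rewrite -(tangent_eq Ac Ak kp tw (f := fun p' =>
  \sum_a coordf k (yI a) p' * partial k (yI a) L p' - L p')); first last.
- exact: smooth_atB.
- apply: (near_ptS Ac Ak kp _ (near_adapted (id_compatible E) acf)) => p' acf'.
  by rewrite /= (energyE acf').
rewrite (tangentD Ac Ak kp tw SS SN) (tangentN Ac Ak kp tw hLp).
rewrite (tangent_sum Ac Ak kp tw) //.
under eq_bigr do rewrite (tangentM Ac Ak kp tw (Sy _) (Sp _)).
rewrite [v L](tvecE Ac Ak kp w hLp) -(sum_partialE Ac Ak kp _ hLp) tot_sum.
rewrite big_split /=.
under [X in _ + X - _]eq_bigr do rewrite /v (tvec_coordf Ac Ak kp) mulrC.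
under [X in _ - (X + _ + _)]eq_bigr do rewrite mulrC.
by ring.
Qed.

(** Each w' is the image of some w, and H o Leg_L = E_L, whose derivative along
    w is expressed by [tvec_energy] through the components of w'. *)
Lemma tvec_H w' : tvec B l (legendre L p) w' H =
  \sum_a coordf k (yI a) p * w' 0 (yI a)
  - \sum_i partial k (qI i) L p * w' 0 (qI i) - partial k sI L p * w' 0 sI.
Proof.
have [w <-] := dlegendre_surj w'.
rewrite -(tvec_legendre w smooth_H) H_legendre tvec_energy.
rewrite dlegendre_sI; congr (_ - _ - _).
  by apply: eq_bigr => a _; rewrite dlegendre_yI.
by apply: eq_bigr => i _; rewrite dlegendre_qI.
Qed.

Lemma partial_tvec_H j : partial l j H (legendre L p) =
  tvec B l (legendre L p) (delta_mx 0 j) H.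
Proof.
by rewrite (partialE Bc Bl lp _ smooth_H) (tvecE Bc Bl lp _ smooth_H).
Qed.

Lemma partial_H_qI i : partial l (qI i) H (legendre L p) = - partial k (qI i) L p.
Proof.
rewrite partial_tvec_H tvec_H !mxE eqxx /= big1 => [|a _]; last first.
  by rewrite mxE (inj_eq (@lshift_inj _ _)) eq_rlshift mulr0.
rewrite (bigD1 i) //= mxE !eqxx mulr1 big1 => [|i' i'i]; last first.
  by rewrite mxE !(inj_eq (@lshift_inj _ _)) (negbTE i'i) mulr0.
by rewrite eq_rlshift mulr0 addr0 subr0 add0r.
Qed.

Lemma partial_H_yI a : partial l (yI a) H (legendre L p) = coordf k (yI a) p.
Proof.
rewrite partial_tvec_H tvec_H !mxE eqxx /= (bigD1 a) //= mxE !eqxx mulr1.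
rewrite big1 => [|b ba]; last first.
  rewrite mxE (inj_eq (@lshift_inj _ _)) (inj_eq (@rshift_inj _ _)) (negbTE ba).
  by rewrite mulr0.
rewrite big1 => [|i _]; last first.
  by rewrite mxE (inj_eq (@lshift_inj _ _)) eq_lrshift mulr0.
by rewrite eq_rlshift mulr0 addr0 !subr0.
Qed.

Lemma partial_H_sI : partial l sI H (legendre L p) = - partial k sI L p.
Proof.
rewrite partial_tvec_H tvec_H !mxE !eqxx mulr1.
rewrite big1 => [|a _]; last by rewrite mxE eq_lrshift mulr0.
rewrite big1 => [|i _]; last by rewrite mxE eq_lrshift mulr0.
by rewrite subr0 add0r.
Qed.

End Legendre.

(** * Related sections and equivalent equations *)

(** Non-degeneracy of the contact equations: testing on (W, u, us) = (0, 0, 1)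
    identifies the two Reeb derivatives, testing on u identifies the
    X-components, and then testing on W identifies the derivatives of theta. *)
Lemma contact_pairing_inj (R : realType) (r : nat)
    (Z G zeta gamma theta : 'I_r -> R) (C : 'I_r -> 'I_r -> 'I_r -> R)
    (rho rho' : R) :
  (forall (W u : 'I_r -> R) (us : R),
    \sum_a (u a * Z a - zeta a * W a)
      + \sum_d theta d * \sum_a \sum_b Z a * W b * C a b d
      + rho' * (us - \sum_a theta a * W a) =
    \sum_a (u a * G a - gamma a * W a)
      + \sum_d theta d * \sum_a \sum_b G a * W b * C a b d
      + rho * (us - \sum_a theta a * W a)) ->
  (forall a, Z a = G a) /\ (forall a, zeta a = gamma a).
Proof.
move=> eqs.
have S0 (X : 'I_r -> R) : \sum_d theta d * \sum_a \sum_b X a * 0 * C a b d = 0.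
  rewrite big1 // => d _; rewrite big1 ?mulr0 // => a _; rewrite big1 // => b _.
  by rewrite mulr0 mul0r.
have T0 : \sum_a theta a * 0 = 0 by rewrite big1 // => a _; rewrite mulr0.
have delta (X : 'I_r -> R) a : \sum_b (b == a)%:R * X b = X a.
  by rewrite (bigD1 a) //= eqxx mul1r big1 ?addr0 // => b /negbTE->; rewrite mul0r.
have rhoE : rho' = rho.
  have := eqs (fun=> 0) (fun=> 0) 1; rewrite !S0 T0 !big1 => [|a _|a _].
  - by rewrite !add0r subr0 !mulr1.
  - by rewrite mul0r mulr0 subrr.
  - by rewrite mul0r mulr0 subrr.
have ZG a : Z a = G a.
  have := eqs (fun=> 0) (fun b => (b == a)%:R) 0; rewrite !S0 T0 subrr !mulr0 !addr0.
  under eq_bigr do rewrite mulr0 subr0.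
  under [X in _ = X -> _]eq_bigr do rewrite mulr0 subr0.
  by rewrite !delta.
split=> // a.
have := eqs (fun b => (b == a)%:R) (fun=> 0) 0; rewrite rhoE.
have -> : Z = G by apply/funext.
move=> /addIr/addIr.
under eq_bigr do rewrite mul0r sub0r mulrC.
under [X in _ = X -> _]eq_bigr do rewrite mul0r sub0r mulrC.
by rewrite !sumrN !delta => /oppr_inj.
Qed.

Lemma is_derive_near_eq (R : realType) (f g : R^o -> R^o) (t a b : R^o) :
  (\forall u \near t, f u = g u) -> a = b ->
  is_derive t 1 f a <-> is_derive t 1 g b.
Proof.
move=> fg ->; split; first exact: near_eq_is_derive.
by apply: near_eq_is_derive; apply: filterS fg => u ->.
Qed.

(** In the charts k and l the curve F o gam is the composite of gam read in k
    with F read from k to l. *)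
Lemma smooth_curve_comp (R : realType) (M N : Type) (m n : nat)
    (A : set (chart R M m)) (B : set (chart R N n)) (F : M -> N)
    (I : set R) (gam : R -> M) :
  compatible_atlas A -> (forall p, exists2 k, A k & cdom k p) ->
  smooth_map A B F -> smooth_curve A I gam -> smooth_curve B I (F \o gam).
Proof.
move=> Ac cov SF Sgam t It l Bl lt; have [k Ak kt] := cov (gam t).
have [nk Sk] := Sgam t It k Ak kt; have [nl SFkl] := SF _ k l Ak Bl kt lt.
split.
  move/(near_ptP Ac Ak kt) : nl => nl.
  have nlg := smooth_near_continuous Sk nl.
  apply: filterS2 nk nlg => u ku /=.
  by rewrite (cfromK Ac Ak ku).
have := smooth_near_comp Sk SFkl; apply: smooth_near_eq.
by apply: filterS nk => u ku /=; rewrite (cfromK Ac Ak ku).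
Qed.

Section Relation.
Context {R : realType} {n : nat} {Q : manifold R n} {r : nat}.
Variable E : lie_algebroid Q r.

Let A := atlasE (E := E).
Let B := atlasEd (E := E).
Let Ac : compatible_atlas A := @atlasE_compatible _ _ _ _ E.
Let Bc : compatible_atlas B := @atlasEd_compatible _ _ _ _ E.

Variables (L : totR E -> R) (Leginv : totR (dual E) -> totR E).
Hypothesis hL : smooth_fun A L.
Hypothesis hLeg : hyperregular L Leginv.

Let H : totR (dual E) -> R := energy L \o Leginv.

(** Both sections are compared at Leg_L p, in the coordinates of one adapted
    pair (c, f). *)
Lemma lagrangian_hamiltonian_related
    (reebL GamL : forall p : totR E, prolT E p)
    (reeb xiH : forall p : totR (dual E), prolT E p) :
  lagrangian_section L reebL GamL -> hamiltonian_section H reeb xiH ->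
  forall p, xiH (legendre L p) = prol_legendre L (GamL p).
Proof.
move=> hG hX p; have [c [f acf]] := exists_adapted E p.
pose k := tot_chart c f; pose l := tot_chart c (dual_frame f).
have acf' : adapted (E := E) c f (legendre L p) by exact: acf.
have Ak : A k by exact: tot_chart_atlas acf.
have Bl : B l by exact: tot_chart_atlas acf'.
have kp : cdom k p by exact: (tot_chart_dom (id_compatible E) acf).
have lp : cdom l (legendre L p) by exact: (tot_chart_dom (dual_compatible E) acf').
have etaLE : near_pt A p [set p' | forall z : prolT E p',
    etaL L z = z.2 snd - \sum_a partial k (yI a) L p' * fcoord f a z.1].
  apply: (near_ptS Ac Ak kp _ (near_adapted (id_compatible E) acf)).
  move=> p' acfp' z.
  by rewrite /etaL (ThetaLE acfp').
have etaE : near_pt B (legendre L p) [set p' | forall z : prolT E p',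
    eta_can z = z.2 snd - \sum_a coordf l (yI a) p' * fcoord f a z.1].
  apply: (near_ptS Bc Bl lp _ (near_adapted (dual_compatible E) acf')).
  move=> p' acfp' z.
  by rewrite /eta_can (Theta_canE _ acfp').
have thetaL a : smooth_at A p (partial k (yI a) L) by exact: smooth_partial_L.
have theta a : smooth_at B (legendre L p) (coordf l (yI a)).
  exact: (smooth_at_coordf Bc Bl lp _ Bl lp).
have [sG [rho eqG]] :=
  hamiltonian_section_eqs (id_compatible E) acf thetaL etaLE hG.
have [sX [rho' eqX]] :=
  hamiltonian_section_eqs (dual_compatible E) acf' theta etaE hX.
have [[inG _] _] := hG; have [[inX _] _] := hX.
have [tG _] := inG p; have [tX _] := inX (legendre L p).
set zeta := \row_j (xiH (legendre L p)).2 (coordf l j).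
set gamma := \row_j (GamL p).2 (coordf k j).
have XE := tangent_tvec Bc Bl lp tX; have GE := tangent_tvec Ac Ak kp tG.
have thE a : coordf l (yI a) (legendre L p) = partial k (yI a) L p.
  by rewrite (legendre_yI acf).
have [ZG zg] : (forall a, Xcomp f a xiH (legendre L p) = Xcomp f a GamL p) /\
    (forall a, (xiH (legendre L p)).2 (coordf l (yI a)) =
               (GamL p).2 (partial k (yI a) L)).
  apply: (contact_pairing_inj (theta := fun a => partial k (yI a) L p)
    (C := fun a b d => strf f a b d (bproj p)) (rho := rho) (rho' := rho')).
  move=> W u us.
  pose w' := const_vec c f W u us (bproj p).
  have [w ww'] := dlegendre_surj hLeg acf w'.
  (* w has the q and s components of w', and its y components are whatever
     makes Leg_L map it to w' *)
  have wE : w = const_vec c f W (fun a => w 0 (yI a)) us (bproj p).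
    apply/rowP; apply: (@tot_ind n r) => [i|a|].
    - by rewrite const_vec_qI -(dlegendre_qI hLeg acf) ww' const_vec_qI.
    - by rewrite const_vec_yI.
    - by rewrite const_vec_sI -(dlegendre_sI hLeg acf) ww' const_vec_sI.
  have uX a : tvec B l (legendre L p) w' (coordf l (yI a)) = u a.
    by rewrite (tvec_coordf Bc Bl lp) const_vec_yI.
  have uG a : tvec A k p w (partial k (yI a) L) = u a.
    by rewrite -(dlegendre_yI hL hLeg acf) ww' const_vec_yI.
  have := eqX W u us; have := eqG W (fun a => w 0 (yI a)) us.
  rewrite -wE -/w' /= -(H_legendre hLeg).
  rewrite (tvec_legendre hLeg acf w (smooth_H hL hLeg acf)) ww'.
  under eq_bigr do rewrite uG.
  move=> eG; under eq_bigr do rewrite uX.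
  under [X in _ + X = _ -> _]eq_bigr do rewrite thE.
  under [X in _ = _ - _ * (_ - X) -> _]eq_bigr do rewrite thE.
  by move=> eX; rewrite eG eX !subrK.
have zetaE : zeta = dlegendre L c f p gamma.
  apply/rowP; apply: (@tot_ind n r) => [i|a|].
  - rewrite (dlegendre_qI hLeg acf) !mxE.
    rewrite (in_prol_qI acf' i (inX _)).
    rewrite (in_prol_qI acf i (inG _)).
    by apply: eq_bigr => a _; congr (_ * _); exact: ZG.
  - by rewrite (dlegendre_yI hL hLeg acf) -GE mxE zg.
  - rewrite (dlegendre_sI hLeg acf) !mxE.
    rewrite -(snd_coordf (@dual_frame _ _ _ _ E) c f) -(snd_coordf id c f).
    move: sX sG; under eq_bigr do rewrite thE ZG.
    have -> : H (legendre L p) = energy L p by rewrite -(H_legendre hLeg).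
    by move=> <- /addIr.
rewrite [LHS]surjective_pairing /prol_legendre; congr (_, _).
  exact: (fcoordP (frame_basis acf)).
rewrite XE -/zeta zetaE; apply/funext => h; rewrite /tmap.
case: asboolP => [Sh|Sh]; last by rewrite tvec_nsmooth.
by rewrite -(tvec_legendre hLeg acf gamma Sh) -GE.
Qed.

(** The coordinates q, y, s of the image curve are q, dL/dy, s along the
    original curve, and the partial derivatives of H are those of L up to sign,
    so that corresponding equations have equal right-hand sides. *)
Lemma herglotz_equations_legendre (gam : R -> totR E) t c (f : frame E r) :
  adapted c f (gam t) -> (\forall u \near t, adapted c f (gam u)) ->
  let k := tot_chart c f in
  let l := tot_chart c (dual_frame f) in
  let q := bproj (gam t) in
  let sig := legendre L \o gam in
  let y a := coordf k (yI a) (gam t) in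
  let Lq i := partial k (qI i) L (gam t) in
  let Ly a := partial k (yI a) L (gam t) in
  let Ls := partial k sI L (gam t) in
  let p a := coordf l (yI a) (sig t) in
  let Hq i := partial l (qI i) H (sig t) in
  let Hp a := partial l (yI a) H (sig t) in
  let Hs := partial l sI H (sig t) in
  [/\ forall i, is_derive (t : R^o) 1
          (fun u : R^o => coordf k (qI i) (gam u) : R^o)
          (\sum_a y a * rhof c f i a q) <->
        is_derive (t : R^o) 1 (fun u : R^o => coordf l (qI i) (sig u) : R^o)
          (\sum_a rhof c f i a q * Hp a),
      forall a, is_derive (t : R^o) 1
          (fun u : R^o => partial k (yI a) L (gam u) : R^o)
          (\sum_i rhof c f i a q * Lq i
           - \sum_b \sum_d y b * strf f a b d q * Ly d + Ly a * Ls) <->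
        is_derive (t : R^o) 1 (fun u : R^o => coordf l (yI a) (sig u) : R^o)
          (- (\sum_i rhof c f i a q * Hq i
              + \sum_b \sum_d strf f a b d q * p d * Hp b + p a * Hs)) &
      is_derive (t : R^o) 1 (fun u : R^o => coordf k sI (gam u) : R^o)
          (L (gam t)) <->
        is_derive (t : R^o) 1 (fun u : R^o => coordf l sI (sig u) : R^o)
          (\sum_a p a * Hp a - H (sig t))].
Proof.
move=> acf nacf k l q sig y Lq Ly Ls p Hq Hp Hs.
have HpE a : Hp a = y a by exact: partial_H_yI.
have HqE i : Hq i = - Lq i by exact: partial_H_qI.
have HsE : Hs = - Ls by exact: partial_H_sI.
have pE a : p a = Ly a by exact: legendre_yI.
split=> [i|a|]; apply: is_derive_near_eq.
- by apply: filterS nacf => u _; rewrite [RHS]legendre_qI.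
- by apply: eq_bigr => a _; rewrite HpE mulrC.
- by apply: filterS nacf => u acfu; rewrite [RHS](legendre_yI acfu).
- rewrite !opprD -!sumrN HsE pE mulrN opprK; congr (_ + _ + _).
    by apply: eq_bigr => i _; rewrite HqE mulrN opprK.
  apply: eq_bigr => b _; rewrite -!sumrN; apply: eq_bigr => d _.
  by rewrite HpE pE; ring.
- by apply: filterS nacf => u _; rewrite [RHS]legendre_sI.
- under eq_bigr do rewrite HpE pE mulrC.
  have -> : H (sig t) = energy L (gam t) by rewrite -(H_legendre hLeg).
  by rewrite (energyE acf) // subKr.
Qed.

(** Smoothness of the curves is transported by Leg_L in one direction and by its
    inverse in the other. *)
Lemma herglotz_iff_hamilton (I : set R) (gam : R -> totR E) :
  herglotz L I gam <-> hamilton H I (legendre L \o gam).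
Proof.
have [LegK _ Leg_smooth Leginv_smooth] := hLeg.
have scE : smooth_curve A I gam <-> smooth_curve B I (legendre L \o gam).
  have covA := tot_atlas_cover (id_compatible E).
  have covB := tot_atlas_cover (dual_compatible E).
  split=> [|S]; first exact: (smooth_curve_comp Ac covA Leg_smooth).
  have -> : gam = Leginv \o (legendre L \o gam).
    by apply/funext => u /=; rewrite LegK.
  exact: (smooth_curve_comp Bc covB Leginv_smooth S).
have near_ad c (f : frame E r) t : smooth_curve A I gam -> I t ->
    adapted c f (gam t) ->
    \forall u \near t, adapted c f (gam u).
  move=> S It acf; have [Acc Vf _ _] := acf.
  have kt := tot_chart_dom (id_compatible E) acf.
  have [nk _] := S t It _ (tot_chart_atlas id acf) kt.
  by apply: filterS nk => u [].
split=> [[S eqs]|[/scE S eqs]]; split; try exact/scE; move=> //.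
  move=> t It c f acf.
  have [hq hy hs] := herglotz_equations_legendre acf (near_ad c f t S It acf).
  have [ey eq es] := eqs t It c f acf.
  by split=> [i|a|]; [exact/hq|exact/hy|exact/hs].
move=> t It c f acf.
have [hq hy hs] := herglotz_equations_legendre acf (near_ad c f t S It acf).
have [eq ey es] := eqs t It c f acf.
by split=> [a|i|]; [exact/hy|exact/hq|exact/hs].
Qed.

End Relation.

Theorem theorem5p11 (R : realType) (n r : nat) (Q : manifold R n)
    (E : lie_algebroid Q r)
    (L : totR E -> R) (hL : smooth_fun (atlasE (E := E)) L)
    (Leginv : totR (dual E) -> totR E) (hLeg : hyperregular L Leginv) :
  let H : totR (dual E) -> R := energy L \o Leginv in
  (forall (reebL GamL : forall p : totR E, prolT E p)
          (reeb xiH : forall p : totR (dual E), prolT E p),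
     is_reeb id (etaL (E := E) L) reebL ->
     lagrangian_section L reebL GamL ->
     is_reeb (@dual_frame _ _ _ _ E) (eta_can (E := E)) reeb ->
     hamiltonian_section H reeb xiH ->
     forall p : totR E, xiH (legendre L p) = prol_legendre L (GamL p)) /\
  (forall (I : set R) (gam : R -> totR E), open I -> is_interval I ->
     herglotz L I gam -> hamilton H I (legendre L \o gam)) /\
  (forall (I : set R) (sig : R -> totR (dual E)), open I -> is_interval I ->
     hamilton H I sig -> herglotz L I (Leginv \o sig)).
Proof.
move=> H; split; [|split].
- move=> reebL GamL reeb xiH _ hG _ hX p.
  exact: (lagrangian_hamiltonian_related hL hLeg hG hX).
- by move=> I gam _ _ /(herglotz_iff_hamilton hL hLeg).
- move=> I sig _ _ hsig; apply/(herglotz_iff_hamilton hL hLeg).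
  have [_ LeginvK _ _] := hLeg.
  by rewrite (_ : legendre L \o _ = sig) //; apply/funext => u /=; rewrite LeginvK.
Qed.
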